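(* The functor $F_{\vec{o}}:\mathrm{Rep}(\Gamma_{\vec{o}})\longrightarrow\mathcal{K}^0_0$ is an equivalence of abelian categories.
   Context: $\Gamma$ is a connected Dynkin diagram of type ADE with vertex set $I$ and orientation $\vec{o}$; $\Gamma_{\vec{o}}$ is the resulting quiver. Zigzag algebra. Let $\bar\Gamma$ be the quiver obtained by replacing each edge of $\Gamma$ by two opposite arrows; paths are composed from left to right. $A_\Gamma$ is the quotient of the complex path algebra of $\bar\Gamma$ by: length-two paths with distinct endpoints are $0$; all length-two paths starting and ending at the same vertex are equal. (Type $A_1$: $A_\Gamma=\mathbb{C}[x]/(x^2)$; type $A_2$: quotient of the path algebra by all paths of length three.) It is bigraded by path length and by orientation degree (arrows agreeing with $\vec{o}$ have degree $0$, the opposite ones degree $1$; in type $A_1$, $x$ has path length $2$ and orientation degree $1$). Shifts are written $\langle\cdot\rangle$ (path length) and $\{\cdot\}$ (orientation), with the convention that an element of bidegree $(a,b)$ of $M$ has bidegree $(a+k,b+l)$ in $M\langle k\rangle\{l\}$. $P_i=A_\Gamma e_i$, where $e_i$ is the length-zero path at $i$. $\mathcal{K}$ is the homotopy category of bounded complexes of finitely generated bigraded projective left $A_\Gamma$-modules (with bidegree-$0$ maps), $Y[k]^m=Y^{k+m}$. Each object has a minimal complex (a representative without contractible summands), unique up to isomorphism. $\mathcal{K}^0_0\subset\mathcal{K}$ is the full subcategory of objects whose minimal complex has underlying chain group a direct sum of terms $P_i\{0\}\langle-k\rangle[-k]$, i.e. of modules $P_i\{0\}\langle-k\rangle$ placed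 in cohomological degree $k$ (the intersection of the heart of the canonical $t$-structure with the baric heart of $\vec{o}$). $\mathrm{Rep}(\Gamma_{\vec{o}})$ is the abelian category of finite-dimensional graded complex representations $(V_i,f_{ij})$ of $\Gamma_{\vec{o}}$: each $V_i=\bigoplus_{m\in\mathbb{Z}}V_i(m)$ is a graded vector space and the linear map $f_{ij}:V_i\to V_j$ attached to an arrow $i\to j$ has degree $1$, i.e. $f_{ij}(V_i(m))\subset V_j(m+1)$; morphisms are degree-$0$ morphisms of representations. The functor $F_{\vec{o}}$ sends $(V_i,f_{ij})$ to the complex with underlying projective module $\bigoplus_i\bigoplus_mP_i\langle-m\rangle[-m]\otimes_{\mathbb{C}}V_i(m)$ and differential $d=\bigoplus_{i\to j}f_{ij}x_{ij}$, where $x_{ij}$ denotes the map $P_i\to P_j\langle-1\rangle$ given by right multiplication by the arrow from $i$ to $j$ in the zigzag algebra; a morphism $(g_i:V_i\to V_i')$ is sent to the chain map with components $\mathrm{id}_{P_i}\otimes g_i$. *)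

(* Defs.v *)
From HB Require Import structures.
From mathcomp Require Import all_boot all_order all_algebra.
From mathcomp Require Import generic_quotient ring_quotient finmap.
From mathcomp Require Import boolp reals complex.
From mathcomp Require Import monalg.

Set Implicit Arguments.
Unset Strict Implicit.
Unset Printing Implicit Defensive.

Import GRing.Theory.
Local Open Scope ring_scope.
Local Open Scope quotient_scope.

Inductive ade_type := TypeA of nat | TypeD of nat | TypeE6 | TypeE7 | TypeE8.

(* TypeA n stands for A_(n+1) and TypeD n for D_(n+4). *)
Definition ade_rank (t : ade_type) : nat :=
  match t with
  | TypeA n => n.+1 | TypeD n => n.+4
  | TypeE6 => 6 | TypeE7 => 7 | TypeE8 => 8
  end.

(* A diagram with m vertices is the chain 0 - 1 - ... - m-2 together with the
   vertex m-1, which is joined to the vertex ade_branch. *)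
Definition ade_branch (t : ade_type) : nat :=
  match t with TypeA n => n.-1 | TypeD n => n.+1 | _ => 2 end.

Definition ade_edge (t : ade_type) (i j : nat) : bool :=
  (i < j)%N && (if j.+1 == ade_rank t then i == ade_branch t else j == i.+1).

Definition is_ade (I : finType) (e : rel I) : Prop :=
  exists (t : ade_type) (f : I -> 'I_(ade_rank t)),
    bijective f /\
    forall i j, e i j = ade_edge t (f i) (f j) || ade_edge t (f j) (f i).

Record ade_quiver := AdeQuiver {
  vertex :> finType;
  adj : rel vertex;
  arrow : rel vertex;
  adj_ade : is_ade adj;
  adj_arrow : forall i j, adj i j = arrow i j || arrow j i;
  arrow_asym : forall i j, ~~ (arrow i j && arrow j i) }.

Lemma ade_vertex (G : ade_quiver) : inhabited G.
Proof.
have [t [f [[g _ _] _]]] := adj_ade G.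
by case: t f g => [n|n|||] f g; exists; apply: (g ord0).
Qed.

Section Paths.
Variable G : ade_quiver.

(* In type A_1 the doubled quiver has no arrow; we give it one loop, namely
   the generator x of C[x]/(x^2).  Its path length is 2 and, since it is not
   an arrow of G, its orientation degree is 1. *)
Definition typeA1 : bool := #|G| == 1%N.
Definition dstep : rel G := fun i j => adj i j || typeA1.

(* The path through the vertices i, s_0, s_1, ... is stored as (i, s). *)
Record qpath := QPath {
  pval : G * seq G;
  _ : path dstep pval.1 pval.2 }.
HB.instance Definition _ := [isSub for pval].
HB.instance Definition _ := [Choice of qpath by <:].

Definition psrc (p : qpath) : G := (val p).1.
Definition psteps (p : qpath) : seq G := (val p).2.
Definition ptgt (p : qpath) : G := last (psrc p) (psteps p).
Definition psize (p : qpath) : nat := size (psteps p).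

Fixpoint odeg (i : G) (s : seq G) : nat :=
  if s is j :: s' then (~~ arrow i j + odeg j s')%N else 0%N.

(* bidegree: (path length, orientation degree) *)
Definition pdeg (p : qpath) : int * int :=
  (((if typeA1 then 2 else 1) * psize p)%N%:Z, (odeg (psrc p) (psteps p))%:Z).

(* None when the paths are not composable; the insub always succeeds. *)
Definition pcat (p q : qpath) : option qpath :=
  if ptgt p == psrc q then insub (psrc p, psteps p ++ psteps q) else None.

Definition ptriv (i : G) : qpath := @QPath (i, [::]) isT.

Lemma psteps_path p : path dstep (psrc p) (psteps p).
Proof. by case: p. Qed.

Lemma pcatP p q : ptgt p = psrc q ->
  {r | pcat p q = Some r & val r = (psrc p, psteps p ++ psteps q)}.
Proof.
move=> e; have h : path dstep (psrc p) (psteps p ++ psteps q).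
  by rewrite cat_path psteps_path /= -/(ptgt p) e psteps_path.
by exists (@QPath (psrc p, psteps p ++ psteps q) h) => //;
  rewrite /pcat e eqxx insubT.
Qed.

Lemma pcat_some p q r : pcat p q = Some r ->
  ptgt p = psrc q /\ val r = (psrc p, psteps p ++ psteps q).
Proof.
rewrite /pcat; case: eqP => // e; case: insubP => // u _ vu [<-].
by split.
Qed.

Lemma pcat_none p q : ptgt p <> psrc q -> pcat p q = None.
Proof. by move/eqP/negbTE; rewrite /pcat => ->. Qed.

Lemma pcat_src p q r : pcat p q = Some r -> psrc r = psrc p.
Proof. by case/pcat_some=> _ vr; rewrite /psrc vr. Qed.

Lemma pcat_tgt p q r : pcat p q = Some r -> ptgt r = ptgt q.
Proof.
case/pcat_some=> e vr; rewrite {1}/ptgt /psrc /psteps vr /= last_cat.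
by rewrite -/(ptgt p) e.
Qed.

Lemma obind_pcatA p q r :
  obind (pcat p) (pcat q r) = obind (pcat^~ r) (pcat p q).
Proof.
have [e1|ne1] := eqVneq (ptgt p) (psrc q); last first.
  rewrite (pcat_none (elimN eqP ne1)) /=.
  case h : (pcat q r) => [s|] //=; apply: pcat_none.
  by rewrite (pcat_src h); apply/eqP.
have [u hu vu] := pcatP e1; rewrite hu /=.
have [e2|ne2] := eqVneq (ptgt q) (psrc r); last first.
  rewrite (pcat_none (elimN eqP ne2)) /= pcat_none //.
  by rewrite (pcat_tgt hu); apply/eqP.
have [v hv vv] := pcatP e2; rewrite hv /=.
have e3 : ptgt p = psrc v by rewrite (pcat_src hv).
have e4 : ptgt u = psrc r by rewrite (pcat_tgt hu).
have [w hw vw] := pcatP e3; have [z hz vz] := pcatP e4.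
rewrite hw hz; congr Some; apply: val_inj; rewrite vw vz.
by rewrite /psrc /psteps vu vv /= catA.
Qed.

Lemma pcat_trivl i p : pcat (ptriv i) p = if i == psrc p then Some p else None.
Proof.
case: eqP => [->|ne]; last exact: pcat_none.
have [r -> vr] := @pcatP (ptriv (psrc p)) p erefl.
by congr Some; apply: val_inj; rewrite vr; case: (p) => -[].
Qed.

Lemma pcat_trivr i p : pcat p (ptriv i) = if i == ptgt p then Some p else None.
Proof.
case: eqP => [->|ne]; last by apply: pcat_none => e; apply: ne.
have [r -> vr] := @pcatP p (ptriv (ptgt p)) erefl.
by congr Some; apply: val_inj; rewrite vr /= cats0; case: (p) => -[].
Qed.

Lemma odeg_cat i s t : odeg i (s ++ t) = (odeg i s + odeg (last i s) t)%N.
Proof. by elim: s i => //= j s IH i; rewrite IH addnA. Qed.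

Lemma pdeg_cat p q r : pcat p q = Some r -> pdeg r = pdeg p + pdeg q.
Proof.
case/pcat_some => e vr; rewrite /pdeg /psize {1 2 3}/psteps {1}/psrc vr /=.
by rewrite size_cat odeg_cat -/(ptgt p) e mulnDr !PoszD.
Qed.

Lemma adj_irr (i : G) : adj i i = false.
Proof.
by have := arrow_asym i i; rewrite adj_arrow orbb andbb => /negbTE.
Qed.

Lemma adj_sym (i j : G) : adj i j = adj j i.
Proof. by rewrite !adj_arrow orbC. Qed.

Lemma arrow_dstep (i j : G) : arrow i j -> dstep i j.
Proof. by move=> h; rewrite /dstep adj_arrow h. Qed.

Lemma arrow_neq (i j : G) : arrow i j -> i != j.
Proof.
move=> h; apply/eqP => e; move: h; rewrite e => h.
by have := arrow_asym j j; rewrite h.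
Qed.

Lemma arrow_not_typeA1 (i j : G) : arrow i j -> typeA1 = false.
Proof.
move=> h; apply/negbTE; rewrite /typeA1; apply: contraNneq (arrow_neq h) => c.
by have /fintype_le1P/(_ i j) -> : (#|G| <= 1)%N by rewrite c.
Qed.

Lemma parrow_proof (i j : G) : arrow i j -> path dstep i [:: j].
Proof. by move=> h; rewrite /= arrow_dstep. Qed.

Definition parrow (i j : G) (h : arrow i j) : qpath :=
  @QPath (i, [:: j]) (parrow_proof h).

Lemma pdeg_arrow (i j : G) (h : arrow i j) : pdeg (parrow h) = (1, 0).
Proof. by rewrite /pdeg /= (arrow_not_typeA1 h) /psize /= h. Qed.

Lemma pdeg_triv i : pdeg (ptriv i) = 0.
Proof. by rewrite /pdeg /psize /= muln0. Qed.
End Paths.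

Lemma malg_scaleE (K : fieldType) (T : choiceType) (x : {malg K[T]}) :
  x = \sum_(k <- msupp x) x@_k *: << k >>.
Proof.
rewrite {1}(monalgE x); apply: eq_bigr => k _; apply/malgP => l.
by rewrite mcoeffZ !mcoeffU mulr_natr.
Qed.

Section PathAlgebra.
Variables (K : fieldType) (G : ade_quiver).

Definition pathalg : Type := {malg K[qpath G]}.
HB.instance Definition _ := GRing.Lmodule.on pathalg.

Implicit Types x y z : pathalg.
Implicit Types p q r : qpath G.

Fact pathalg_key : unit. Proof. by []. Qed.

Definition pbase : qpath G -> pathalg :=
  locked_with pathalg_key (fun p => << p >>).
Lemma pbaseE p : pbase p = << p >>. Proof. by rewrite /pbase unlock. Qed.

Definition pbase_mul p q : pathalg :=
  if pcat p q is Some r then pbase r else 0.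

Definition pmul : pathalg -> pathalg -> pathalg :=
  locked_with pathalg_key (fun x y =>
    \sum_(p <- msupp x) \sum_(q <- msupp y) (x@_p * y@_q) *: pbase_mul p q).

Definition pone : pathalg := \sum_(i : G) pbase (ptriv i).

Section Lext.
Variables (L : lmodType K) (f : qpath G -> L).
Definition lext x : L := \sum_(p <- msupp x) x@_p *: f p.

Lemma lextw (d : {fset qpath G}) x : (msupp x `<=` d)%fset ->
  lext x = \sum_(p <- d) x@_p *: f p.
Proof.
move=> le; rewrite /lext (big_fset_incl _ le) //= => p _ /mcoeff_outdom ->.
by rewrite scale0r.
Qed.

Lemma lext_linear : linear lext.
Proof.
move=> a x y; set d := (msupp x `|` msupp y `|` msupp (a *: x + y))%fset.
have hx : (msupp x `<=` d)%fset.
  by rewrite /d -fsetUA fsubsetUl.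
have hy : (msupp y `<=` d)%fset.
  by rewrite /d (fsetUC (msupp x)) -fsetUA fsubsetUl.
have hz : (msupp (a *: x + y) `<=` d)%fset by rewrite /d fsubsetUr.
rewrite (lextw hx) (lextw hy) (lextw hz) scaler_sumr -big_split /=.
by apply: eq_bigr => p _; rewrite mcoeffD mcoeffZ scalerDl scalerA.
Qed.
HB.instance Definition _ := GRing.isLinear.Build K pathalg L *:%R lext lext_linear.

Lemma lext_base p : lext (pbase p) = f p.
Proof.
rewrite pbaseE (@lextw [fset p]%fset) ?msuppU_le //.
by rewrite big_seq_fset1 mcoeffUU scale1r.
Qed.
End Lext.

Lemma pathalgE x : x = \sum_(p <- msupp x) x@_p *: pbase p.
Proof.
rewrite {1}(malg_scaleE x); apply: eq_bigr => p _.
by rewrite pbaseE.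
Qed.

Lemma pathalg_ext (L : lmodType K) (f g : {linear pathalg -> L}) :
  (forall p, f (pbase p) = g (pbase p)) -> f =1 g.
Proof.
move=> h x; rewrite (pathalgE x) !linear_sum; apply: eq_bigr => p _.
by rewrite !linearZ /= h.
Qed.

Lemma pmulE x y : pmul x y = lext (fun p => lext (pbase_mul p) y) x.
Proof.
rewrite /pmul unlock /lext; apply: eq_bigr => p _; rewrite scaler_sumr.
by apply: eq_bigr => q _; rewrite scalerA.
Qed.

Lemma pmulEr x y : pmul x y = lext (fun q => lext (pbase_mul^~ q) x) y.
Proof.
rewrite /pmul unlock /lext exchange_big; apply: eq_bigr => q _.
rewrite scaler_sumr; apply: eq_bigr => p _.
by rewrite scalerA mulrC.
Qed.

Lemma pmul_linearl y : linear (pmul^~ y).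
Proof. by move=> a x x'; rewrite !pmulE linearP. Qed.
Lemma pmul_linearr x : linear (pmul x).
Proof. by move=> a y y'; rewrite !pmulEr linearP. Qed.
Let pmull y x := pmul x y.
HB.instance Definition _ y := GRing.isLinear.Build K pathalg pathalg *:%R
  (pmull y) (pmul_linearl y).
HB.instance Definition _ x := GRing.isLinear.Build K pathalg pathalg *:%R
  (pmul x) (pmul_linearr x).

Lemma pmul_base p q : pmul (pbase p) (pbase q) = pbase_mul p q.
Proof. by rewrite pmulE !lext_base. Qed.


Lemma pmulA : associative pmul.
Proof.
move=> x y z.
have lin (f g : pathalg -> pathalg) (lf : linear f) (lg : linear g) :
    (forall p, f (pbase p) = g (pbase p)) -> f =1 g.
  pose F : {linear pathalg -> pathalg} :=
    HB.pack f (GRing.isLinear.Build K pathalg pathalg *:%R f lf).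
  pose H : {linear pathalg -> pathalg} :=
    HB.pack g (GRing.isLinear.Build K pathalg pathalg *:%R g lg).
  exact: (@pathalg_ext _ F H).
move: x; apply: (lin) => [a u v|a u v|p].
- by rewrite (pmul_linearl (pmul y z)).
- by rewrite (pmul_linearl y) (pmul_linearl z).
move: y; apply: (lin) => [a u v|a u v|q].
- by rewrite (pmul_linearl z) (pmul_linearr _).
- by rewrite (pmul_linearr _) (pmul_linearl z).
move: z; apply: (lin) => [a u v|a u v|r].
- by rewrite (pmul_linearr (pbase q)) (pmul_linearr (pbase p)).
- by rewrite (pmul_linearr _).
have m0 a : pmul a 0 = 0 by rewrite pmulEr linear0.
have m1 a : pmul 0 a = 0 by rewrite pmulE linear0.
rewrite (pmul_base q r) (pmul_base p q) /pbase_mul.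
have := obind_pcatA p q r.
case: (pcat q r) => [s|]; case: (pcat p q) => [t|] /= h.
- by rewrite (pmul_base p s) (pmul_base t r) /pbase_mul h.
- by rewrite (pmul_base p s) m1 /pbase_mul h.
- by rewrite (pmul_base t r) m0 /pbase_mul -h.
- by rewrite m0 m1.
Qed.

Lemma pmul1l : left_id pone pmul.
Proof.
move=> x; rewrite /pone -[pmul _ x]/(pmull x _) linear_sum /=.
rewrite [RHS]pathalgE.
under eq_bigr => i _ do rewrite /pmull pmulE lext_base /lext.
rewrite exchange_big; apply: eq_bigr => p _; rewrite -scaler_sumr; congr (_ *: _).
rewrite (bigD1 (psrc p)) //= /pbase_mul pcat_trivl eqxx big1 ?addr0 // => i ne.
by rewrite pcat_trivl (negbTE ne).
Qed.

Lemma pmul1r : right_id pone pmul.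
Proof.
move=> x; rewrite /pone linear_sum /=.
rewrite [RHS]pathalgE; under eq_bigr => i _ do rewrite pmulEr lext_base /lext.
rewrite exchange_big; apply: eq_bigr => p _; rewrite -scaler_sumr; congr (_ *: _).
rewrite (bigD1 (ptgt p)) //= /pbase_mul pcat_trivr eqxx big1 ?addr0 // => i ne.
by rewrite pcat_trivr (negbTE ne).
Qed.

Lemma pmulDl : left_distributive pmul +%R.
Proof. by move=> x y z; rewrite -[x]scale1r (pmul_linearl z) !scale1r. Qed.
Lemma pmulDr : right_distributive pmul +%R.
Proof. by move=> x y z; rewrite -[y]scale1r (pmul_linearr x) !scale1r. Qed.

Lemma mcoeff_pbase p q : (pbase p)@_q = (p == q)%:R.
Proof. by rewrite pbaseE mcoeffU. Qed.

Lemma pone_neq0 : pone != 0.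
Proof.
case: (ade_vertex G) => i; apply/eqP => /(congr1 (mcoeff (ptriv i))).
rewrite mcoeff0 /pone raddf_sum (bigD1 i) //= mcoeff_pbase eqxx big1 => [|j ne].
  by move/eqP; rewrite addr0 oner_eq0.
rewrite mcoeff_pbase; case: eqP => // /(congr1 (@psrc G)) e.
by rewrite -[j]/(psrc (ptriv j)) e eqxx in ne.
Qed.

HB.instance Definition _ := GRing.Zmodule_isNzRing.Build pathalg
  pmulA pmul1l pmul1r pmulDl pmulDr pone_neq0.

Lemma pscaleAl (a : K) x y : a *: (x * y) = (a *: x) * y.
Proof. by rewrite -[_ * _]/(pmull y x) -linearZ. Qed.
Lemma pscaleAr (a : K) x y : a *: (x * y) = x * (a *: y).
Proof. by rewrite -[_ * _]/(pmul x y) -linearZ. Qed.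
HB.instance Definition _ := GRing.Lmodule_isLalgebra.Build K pathalg pscaleAl.
HB.instance Definition _ := GRing.Lalgebra_isAlgebra.Build K pathalg pscaleAr.

Lemma pbaseM p q : pbase p * pbase q = pbase_mul p q.
Proof. exact: pmul_base. Qed.
End PathAlgebra.

Section Homogeneous.
Variables (K : fieldType) (G : ade_quiver).
Implicit Types (x y : pathalg K G) (d e : int * int).

Definition homog d x : Prop := forall p, p \in msupp x -> pdeg p = d.

Lemma homogP d x : homog d x <-> forall p, x@_p != 0 -> pdeg p = d.
Proof. by split=> h p; [rewrite mcoeff_neq0|rewrite -mcoeff_neq0]; apply: h. Qed.

Lemma homog0 d : homog d 0.
Proof. by apply/homogP => p; rewrite mcoeff0 eqxx. Qed.

Lemma homogD d x y : homog d x -> homog d y -> homog d (x + y).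
Proof.
move=> /homogP hx /homogP hy; apply/homogP => p; rewrite mcoeffD.
have [->|] := eqVneq (x@_p) 0; first by rewrite add0r; apply: hy.
by move=> /hx.
Qed.

Lemma homogZ (a : K) d x : homog d x -> homog d (a *: x).
Proof.
move=> h; rewrite (pathalgE x) scaler_sumr big_seq.
apply: big_rec => [|p y px hy]; first exact: homog0.
apply: homogD => //; rewrite scalerA; apply/homogP => q.
have -> : ((a * x@_p) *: pbase K p)@_q = (a * x@_p) * (p == q)%:R.
  by rewrite pbaseE; apply: etrans (mcoeffZ _ _ _) _; rewrite mcoeffU.
by case: (p =P q) => [<- _|]; [exact: h|rewrite mulr0 eqxx].
Qed.

Lemma homogN d x : homog d x -> homog d (- x).
Proof. by move=> h; rewrite -scaleN1r; apply: homogZ. Qed.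

Lemma homog_sum (T : Type) (s : seq T) (P : pred T) (F : T -> pathalg K G) d :
  (forall t, P t -> homog d (F t)) -> homog d (\sum_(t <- s | P t) F t).
Proof.
by move=> h; apply: big_rec => [|t y Pt hy]; [exact: homog0|apply/homogD/hy/h].
Qed.

Lemma homog_base p : homog (pdeg p) (pbase K p).
Proof.
by apply/homogP => q; rewrite mcoeff_pbase; case: (p =P q) => [->|]; rewrite ?eqxx.
Qed.

Lemma homogM d e x y : homog d x -> homog e y -> homog (d + e) (x * y).
Proof.
move=> hx hy; rewrite (pathalgE x) (pathalgE y) mulr_suml big_seq.
apply: homog_sum => p px; rewrite mulr_sumr big_seq; apply: homog_sum => q qy.
rewrite -scalerAl -scalerAr pbaseM /pbase_mul; do 2!apply: homogZ.
case h : (pcat p q) => [r|]; last exact: homog0.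
by rewrite -(hx p px) -(hy q qy) -(pdeg_cat h); apply: homog_base.
Qed.

Definition hcomp d : pathalg K G -> pathalg K G :=
  lext (fun p => if pdeg p == d then pbase K p else 0).
HB.instance Definition _ d := GRing.Linear.on (hcomp d).

Lemma hcomp_homog d e x : homog e x -> hcomp d x = if e == d then x else 0.
Proof.
move=> hx; rewrite [in hcomp d x](pathalgE x) linear_sum big_seq /=.
rewrite (eq_bigr (fun p => if e == d then x@_p *: pbase K p else 0)).
  by case: eqP => _; rewrite -big_seq -?pathalgE // big1.
move=> p px; rewrite linearZ /= /hcomp lext_base (hx p px).
by case: eqP => // _; rewrite scaler0.
Qed.

Lemma hcomp_is_homog d x : homog d (hcomp d x).
Proof.
rewrite /hcomp /lext; apply: homog_sum => p _; apply: homogZ.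
by case: eqP => [<-|_]; [apply: homog_base|apply: homog0].
Qed.

Lemma hcomp_sum x : exists s : seq (int * int), x = \sum_(d <- s) hcomp d x.
Proof.
exists (undup [seq pdeg p | p <- msupp x]).
rewrite /hcomp /lext exchange_big [LHS]pathalgE big_seq [RHS]big_seq.
apply: eq_bigr => p px; rewrite (bigD1_seq (pdeg p)) ?undup_uniq //=; last first.
  by rewrite mem_undup map_f.
by rewrite eqxx big1 ?addr0 // => d ne; rewrite eq_sym (negbTE ne) scaler0.
Qed.
End Homogeneous.

Section Zigzag.
Variables (K : fieldType) (G : ade_quiver).
Implicit Types x y r : pathalg K G.

(* With one vertex the relation is x^2 = 0, with two vertices (type A_2) all
   paths of length three vanish. *)
Definition zigzag_rel r : Prop :=
  match #|G| with
  | 1 => exists p, psize p = 2 /\ r = pbase K p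
  | 2 => exists p, psize p = 3 /\ r = pbase K p
  | _ => (exists p, [/\ psize p = 2, psrc p <> ptgt p & r = pbase K p]) \/
         (exists p q, [/\ psize p = 2 /\ psize q = 2,
            psrc p = ptgt p, psrc q = ptgt q, psrc p = psrc q
            & r = pbase K p - pbase K q])
  end.

Definition zigzag_ideal x : Prop :=
  exists s : seq (pathalg K G * pathalg K G * pathalg K G),
    (forall t, t \in s -> zigzag_rel t.1.2) /\
    x = \sum_(t <- s) t.1.1 * t.1.2 * t.2.

Lemma zigzag_idealD x y :
  zigzag_ideal x -> zigzag_ideal y -> zigzag_ideal (x + y).
Proof.
move=> [s [hs ->]] [t [ht ->]]; exists (s ++ t); split; last by rewrite big_cat.
by move=> u; rewrite mem_cat => /orP[/hs|/ht].
Qed.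

Lemma zigzag_ideal0 : zigzag_ideal 0.
Proof. by exists [::]; rewrite big_nil. Qed.

Lemma zigzag_idealMl a x : zigzag_ideal x -> zigzag_ideal (a * x).
Proof.
move=> [s [hs ->]]; exists [seq (a * t.1.1, t.1.2, t.2) | t <- s]; split.
  by move=> u /mapP[t /hs ht ->].
by rewrite big_map mulr_sumr; apply: eq_bigr => t _; rewrite /= !mulrA.
Qed.

Lemma zigzag_idealMr x b : zigzag_ideal x -> zigzag_ideal (x * b).
Proof.
move=> [s [hs ->]]; exists [seq (t.1.1, t.1.2, t.2 * b) | t <- s]; split.
  by move=> u /mapP[t /hs ht ->].
by rewrite big_map mulr_suml; apply: eq_bigr => t _; rewrite /= !mulrA.
Qed.

Lemma zigzag_idealZ (a : K) x : zigzag_ideal x -> zigzag_ideal (a *: x).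
Proof. by move=> h; rewrite -mulr_algl; apply: zigzag_idealMl. Qed.

Lemma zigzag_rel_ideal r : zigzag_rel r -> zigzag_ideal r.
Proof.
move=> h; exists [:: (1, r, 1)]; rewrite big_seq1 mul1r mulr1; split=> // t.
by rewrite inE => /eqP ->.
Qed.

Definition zigzag_idealb : pathalg K G -> bool := fun x => `[< zigzag_ideal x >].

Lemma zigzag_ideal_closed : zmod_closed zigzag_idealb.
Proof.
split=> [|x y /asboolP hx /asboolP hy]; apply/asboolP; first exact: zigzag_ideal0.
by apply: zigzag_idealD => //; rewrite -scaleN1r; apply: zigzag_idealZ.
Qed.
HB.instance Definition _ :=
  GRing.isZmodClosed.Build _ zigzag_idealb zigzag_ideal_closed.

Definition zigzag : Type :=
  Quotient.quot (GRing.ZmodClosed.clone (pathalg K G) zigzag_idealb _).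
HB.instance Definition _ := ZmodQuotient.on zigzag.

Definition zpi (x : pathalg K G) : zigzag := \pi_zigzag x.

Lemma zpi_eq x y : zpi x = zpi y <-> zigzag_ideal (x - y).
Proof.
split=> [/eqP|h]; last apply/eqP.
  by rewrite -Quotient.idealrBE => /asboolP.
by rewrite -Quotient.idealrBE; apply/asboolP.
Qed.

Lemma zpiB x y : zpi (x - y) = zpi x - zpi y.
Proof. by rewrite /zpi raddfB. Qed.
HB.instance Definition _ :=
  GRing.isZmodMorphism.Build (pathalg K G) zigzag zpi zpiB.

Lemma zpi_eq0 x : zpi x = 0 <-> zigzag_ideal x.
Proof. by rewrite -(raddf0 zpi) zpi_eq subr0. Qed.

Lemma zpiK (z : zigzag) : zpi (repr z) = z.
Proof. exact: reprK. Qed.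

Definition zmul (u v : zigzag) : zigzag := zpi (repr u * repr v).
Definition zscale (a : K) (u : zigzag) : zigzag := zpi (a *: repr u).

Lemma zpi_repr x : zigzag_ideal (repr (zpi x) - x).
Proof. by rewrite -zpi_eq zpiK. Qed.

Lemma zpiM x y : zmul (zpi x) (zpi y) = zpi (x * y).
Proof.
rewrite /zmul zpi_eq; set x' := repr _; set y' := repr _.
have -> : x' * y' - x * y = (x' - x) * y' + x * (y' - y).
  by rewrite mulrBl mulrBr addrA subrK.
apply: zigzag_idealD; first exact/zigzag_idealMr/zpi_repr.
exact/zigzag_idealMl/zpi_repr.
Qed.

Lemma zpiZ a x : zscale a (zpi x) = zpi (a *: x).
Proof. by rewrite /zscale zpi_eq -scalerBr; apply/zigzag_idealZ/zpi_repr. Qed.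

Lemma zigzag_rel_size r p : zigzag_rel r -> r@_p != 0 -> (1 < psize p)%N.
Proof.
have h (q : qpath G) n : psize q = n.+2 -> (pbase K q)@_p != 0 -> (1 < psize p)%N.
  by move=> e; rewrite mcoeff_pbase; case: (q =P p) => [<-|]; rewrite ?e ?eqxx.
have hr : (exists p, [/\ psize p = 2, psrc p <> ptgt p & r = pbase K p]) \/
         (exists p q, [/\ psize p = 2 /\ psize q = 2,
            psrc p = ptgt p, psrc q = ptgt q, psrc p = psrc q
            & r = pbase K p - pbase K q]) -> r@_p != 0 -> (1 < psize p)%N.
  case=> [[q [e _ ->]]|[q [q' [[e e'] _ _ _ ->]]]]; first exact: h e.
  rewrite mcoeffB => n0; have [z|] := eqVneq ((pbase K q)@_p) 0; last exact: h e.
  by apply: (h _ _ e'); move: n0; rewrite z sub0r oppr_eq0.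
rewrite /zigzag_rel; case: #|G| => [//|[|[|n]]] //; by case=> q [e ->]; apply: h e.
Qed.

Lemma zigzag_ideal_triv x i : zigzag_ideal x -> x@_(ptriv i) = 0.
Proof.
pose long (y : pathalg K G) := forall p, y@_p != 0 -> (1 < psize p)%N.
have l0 : long 0 by move=> p; rewrite mcoeff0 eqxx.
have lD y z : long y -> long z -> long (y + z).
  move=> hy hz p; rewrite mcoeffD; have [->|/hy //] := eqVneq (y@_p) 0.
  by rewrite add0r; apply: hz.
have lM y z : long y \/ long z -> long (y * z).
  move=> hyz; rewrite (pathalgE y) (pathalgE z) mulr_suml big_seq.
  apply: (big_ind long) => // p py; rewrite mulr_sumr big_seq.
  apply: (big_ind long) => // q qz; rewrite -scalerAl -scalerAr scalerA pbaseM.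
  rewrite /pbase_mul; case h : (pcat p q) => [r|]; last by rewrite scaler0.
  move=> t; have -> c : (c *: pbase K r)@_t = c * (r == t)%:R.
    by rewrite pbaseE; apply: etrans (mcoeffZ _ _ _) _; rewrite mcoeffU.
  case: (r =P t) => [<- _|]; last by rewrite mulr0 eqxx.
  have [_ vr] := pcat_some h; rewrite /psize /psteps vr size_cat.
  case: hyz => [/(_ p)|/(_ q)]; rewrite mcoeff_neq0.
    by move=> /(_ py) H; apply: leq_trans H (leq_addr _ _).
  by move=> /(_ qz) H; apply: leq_trans H (leq_addl _ _).
move=> [s [hs ->]].
have: long (\sum_(t <- s) t.1.1 * t.1.2 * t.2).
  rewrite big_seq; apply: (big_ind long) => // t /hs ht.
  by apply: (lM); left; apply: (lM); right => p; apply: zigzag_rel_size.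
by move=> /(_ (ptriv i)) H; apply/eqP/negPn/negP => /H.
Qed.

Lemma zmulA : associative zmul.
Proof.
move=> u v w; rewrite -(zpiK u) -(zpiK v) -(zpiK w).
by rewrite !zpiM mulrA.
Qed.
Lemma zmul1l : left_id (zpi 1) zmul.
Proof. by move=> u; rewrite -(zpiK u) zpiM mul1r. Qed.
Lemma zmul1r : right_id (zpi 1) zmul.
Proof. by move=> u; rewrite -(zpiK u) zpiM mulr1. Qed.
Lemma zmulDl : left_distributive zmul +%R.
Proof.
move=> u v w; rewrite -(zpiK u) -(zpiK v) -(zpiK w).
by rewrite -raddfD !zpiM mulrDl raddfD.
Qed.
Lemma zmulDr : right_distributive zmul +%R.
Proof.
move=> u v w; rewrite -(zpiK u) -(zpiK v) -(zpiK w).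
by rewrite -raddfD !zpiM mulrDr raddfD.
Qed.
Lemma zone_neq0 : zpi 1 != 0.
Proof.
apply/eqP; rewrite zpi_eq0 => h; case: (ade_vertex G) => i.
have := zigzag_ideal_triv i (zigzag_idealMl (pbase K (ptriv i)) h).
by rewrite mulr1 mcoeff_pbase eqxx => /eqP; rewrite oner_eq0.
Qed.
HB.instance Definition _ := GRing.Zmodule_isNzRing.Build zigzag
  zmulA zmul1l zmul1r zmulDl zmulDr zone_neq0.

Lemma zscaleA a b u : zscale a (zscale b u) = zscale (a * b) u.
Proof. by rewrite -(zpiK u) !zpiZ scalerA. Qed.
Lemma zscale1 : left_id 1 zscale.
Proof. by move=> u; rewrite -(zpiK u) zpiZ scale1r. Qed.
Lemma zscaleDr : right_distributive zscale +%R.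
Proof.
move=> a u v; rewrite -(zpiK u) -(zpiK v) -raddfD !zpiZ scalerDr.
by rewrite raddfD.
Qed.
Lemma zscaleDl u : {morph zscale^~ u : a b / a + b}.
Proof. by move=> a b; rewrite -(zpiK u) !zpiZ scalerDl raddfD. Qed.
HB.instance Definition _ := GRing.Zmodule_isLmodule.Build K zigzag
  zscaleA zscale1 zscaleDr zscaleDl.

Lemma zscaleAl (a : K) (u v : zigzag) : a *: (u * v) = (a *: u) * v.
Proof.
change (zscale a (zmul u v) = zmul (zscale a u) v).
by rewrite -(zpiK u) -(zpiK v) zpiM !zpiZ zpiM -scalerAl.
Qed.
Lemma zscaleAr (a : K) (u v : zigzag) : a *: (u * v) = u * (a *: v).
Proof.
change (zscale a (zmul u v) = zmul u (zscale a v)).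
by rewrite -(zpiK u) -(zpiK v) zpiM !zpiZ zpiM -scalerAr.
Qed.
HB.instance Definition _ := GRing.Lmodule_isLalgebra.Build K zigzag zscaleAl.
HB.instance Definition _ := GRing.Lalgebra_isAlgebra.Build K zigzag zscaleAr.

Lemma zpi_mul x y : zpi (x * y) = zpi x * zpi y.
Proof. by rewrite -[RHS]/(zmul _ _) zpiM. Qed.

Lemma zpi_scale a x : zpi (a *: x) = a *: zpi x.
Proof. by rewrite -[RHS]/(zscale _ _) zpiZ. Qed.

(* The relations are homogeneous, so the bigrading descends to the quotient. *)
Definition zgr (d : int * int) (u : zigzag) : Prop :=
  exists x, homog d x /\ u = zpi x.

Lemma zigzag_rel_homog r : zigzag_rel r -> exists d, homog d r.
Proof.
have h p : r = pbase K p -> exists d, homog d r.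
  by move=> ->; exists (pdeg p); apply: homog_base.
have hr : typeA1 G = false ->
  (exists p, [/\ psize p = 2, psrc p <> ptgt p & r = pbase K p]) \/
         (exists p q, [/\ psize p = 2 /\ psize q = 2,
            psrc p = ptgt p, psrc q = ptgt q, psrc p = psrc q
            & r = pbase K p - pbase K q]) -> exists d, homog d r.
  move=> nA1; case=> [[p [_ _]]|[p [q [[sp sq] cp cq epq ->]]]]; first exact: h.
  have loop (t : qpath G) : psize t = 2 -> psrc t = ptgt t -> pdeg t = (2, 1).
    case: t => -[i [|j [|k [|//]]]] // hp _; rewrite /ptgt /psrc /= => e.
    rewrite -{}e {k} in hp *; rewrite /pdeg /psize nA1 /psteps /psrc /= addn0.
    have := hp; rewrite /= {1}/dstep nA1 orbF adj_arrow => /andP[+ _].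
    by have := arrow_asym i j; case: (arrow i j); case: (arrow j i).
  exists (2, 1); apply: homogD; last apply: homogN.
    by rewrite -(loop p) //; apply: homog_base.
  by rewrite -(loop q) //; apply: homog_base.
rewrite /zigzag_rel; case c : #|G| => [|[|[|n]]].
- by apply: hr; rewrite /typeA1 c.
- by case=> p [_]; apply: h.
- by case=> p [_]; apply: h.
- by apply: hr; rewrite /typeA1 c.
Qed.

Lemma zigzag_ideal_hcomp d x : zigzag_ideal x -> zigzag_ideal (hcomp d x).
Proof.
move=> [s [hs ->]]; rewrite linear_sum big_seq /=.
apply: (big_ind zigzag_ideal) => [||[[a r] b] /hs hr] /=.
- exact: zigzag_ideal0.
- exact: zigzag_idealD.
have [e he] := zigzag_rel_homog hr.
rewrite (pathalgE a) (pathalgE b) !mulr_suml linear_sum.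
apply: (big_ind zigzag_ideal) => [||p _].
- exact: zigzag_ideal0.
- exact: zigzag_idealD.
rewrite mulr_sumr linear_sum; apply: (big_ind zigzag_ideal) => [||q _].
- exact: zigzag_ideal0.
- exact: zigzag_idealD.
rewrite -!scalerAl -scalerAr !linearZ /=; do 2!apply: zigzag_idealZ.
rewrite (@hcomp_homog _ _ _ (pdeg p + e + pdeg q)); last first.
  by do !apply: homogM => //; apply: homog_base.
case: ifP => _; last exact: zigzag_ideal0.
exact/zigzag_idealMr/zigzag_idealMl/zigzag_rel_ideal.
Qed.

Definition zcomp d (u : zigzag) : zigzag := zpi (hcomp d (repr u)).

Lemma zcomp_pi d x : zcomp d (zpi x) = zpi (hcomp d x).
Proof.
by rewrite /zcomp zpi_eq -linearB; apply/zigzag_ideal_hcomp/zpi_repr.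
Qed.

Lemma zcompB d : zmod_morphism (zcomp d).
Proof.
move=> u v; rewrite -(zpiK u) -(zpiK v) -raddfB !zcomp_pi linearB.
by rewrite raddfB.
Qed.
HB.instance Definition _ d :=
  GRing.isZmodMorphism.Build zigzag zigzag (zcomp d) (zcompB d).

Lemma zcomp_gr d e u : zgr e u -> zcomp d u = if e == d then u else 0.
Proof.
move=> [x [hx ->]]; rewrite zcomp_pi (hcomp_homog d hx).
by case: ifP => // _; rewrite raddf0.
Qed.

Lemma zgr_direct (s : seq (int * int)) (c : int * int -> zigzag) :
  uniq s -> (forall d, zgr d (c d)) -> \sum_(d <- s) c d = 0 ->
  forall d, d \in s -> c d = 0.
Proof.
move=> us hc h d ds; have := congr1 (zcomp d) h.
rewrite raddf0 raddf_sum (bigD1_seq d) //= (zcomp_gr d (hc d)) eqxx.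
rewrite big1 ?addr0 // => e ne.
by rewrite (zcomp_gr d (hc e)) (negbTE ne).
Qed.

Lemma zgr_span u : exists s : seq zigzag,
  (forall v, v \in s -> exists d, zgr d v) /\ u = \sum_(v <- s) v.
Proof.
have [s hs] := hcomp_sum (repr u); exists [seq zpi (hcomp d (repr u)) | d <- s].
split; last by rewrite big_map -{1}(zpiK u) {1}hs raddf_sum.
move=> v /mapP[d _ ->]; exists d, (hcomp d (repr u)).
by split=> //; apply: hcomp_is_homog.
Qed.

Lemma zgr0 d : zgr d 0.
Proof. by exists 0; rewrite raddf0; split=> //; apply: homog0. Qed.

Lemma zgrD d u v : zgr d u -> zgr d v -> zgr d (u + v).
Proof.
move=> [x [hx ->]] [y [hy ->]]; exists (x + y); rewrite raddfD.
by split=> //; apply: homogD.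
Qed.

Lemma zgrN d u : zgr d u -> zgr d (- u).
Proof.
by move=> [x [hx ->]]; exists (- x); rewrite raddfN; split=> //; apply: homogN.
Qed.

Lemma zgrM d e u v : zgr d u -> zgr e v -> zgr (d + e) (u * v).
Proof.
move=> [x [hx ->]] [y [hy ->]]; exists (x * y); rewrite zpi_mul.
by split=> //; apply: homogM.
Qed.

Definition zidem (i : G) : zigzag := zpi (pbase K (ptriv i)).
Definition zarrow (i j : G) (h : arrow i j) : zigzag := zpi (pbase K (parrow h)).

Lemma zidem_gr i : zgr 0 (zidem i).
Proof.
by exists (pbase K (ptriv i)); split=> //; rewrite -(pdeg_triv i); apply: homog_base.
Qed.

Lemma zarrow_gr i j (h : arrow i j) : zgr (1, 0) (zarrow h).
Proof.
exists (pbase K (parrow h)); split=> //.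
by rewrite -(pdeg_arrow h); apply: homog_base.
Qed.

Lemma zidemM i : zidem i * zidem i = zidem i.
Proof. by rewrite /zidem -zpi_mul pbaseM /pbase_mul pcat_trivl eqxx. Qed.

Lemma zidem_arrow i j (h : arrow i j) : zidem i * zarrow h = zarrow h.
Proof.
by rewrite /zidem /zarrow -zpi_mul pbaseM /pbase_mul pcat_trivl /psrc /= eqxx.
Qed.

Lemma zarrow_idem i j (h : arrow i j) : zarrow h * zidem j = zarrow h.
Proof.
by rewrite /zidem /zarrow -zpi_mul pbaseM /pbase_mul pcat_trivr /ptgt /= eqxx.
Qed.

Lemma zarrowM i j k (h : arrow i j) (l : arrow j k) : zarrow h * zarrow l = 0.
Proof.
have nik : i != k.
  by apply/eqP => e; have := arrow_asym i j; rewrite h /= {1}e l.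
have nij := arrow_neq h; have njk := arrow_neq l.
have u3 : uniq [:: i; j; k] by rewrite /= !inE negb_or nij nik njk.
have c3 : (2 < #|G|)%N by have := max_card (mem [:: i; j; k]); rewrite (card_uniqP u3).
rewrite /zarrow -zpi_mul pbaseM /pbase_mul.
have [r -> vr] : {r | pcat (parrow h) (parrow l) = Some r
    & val r = (psrc (parrow h), psteps (parrow h) ++ psteps (parrow l))}.
  exact: pcatP.
apply/zpi_eq0/zigzag_rel_ideal; rewrite /zigzag_rel.
case: #|G| c3 => [|[|[|n]]] // _; left; exists r.
rewrite /psize /ptgt /psrc /psteps vr; split=> //=.
by apply/eqP.
Qed.
End Zigzag.

Section LeftModules.
Variables (K : fieldType) (A : algType K).

Definition fin_gen (M : lmodType A) : Prop :=
  exists (T : finType) (v : T -> M), forall x, exists c : T -> A,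
    x = \sum_t c t *: v t.

Definition projective (M : lmodType A) : Prop :=
  forall (X Y : lmodType A) (g : {linear X -> Y}) (f : {linear M -> Y}),
    (forall y, exists x, g x = y) ->
    exists h : {linear M -> X}, forall m, g (h m) = f m.

Section LeftIdeal.
Variable e : A.

(* membership in A e *)
Definition in_lideal (x : A^o) : bool := `[< exists a : A, x = a * e :> A >].

Lemma in_lideal_closed : submod_closed in_lideal.
Proof.
split=> [|a x y /asboolP[b xb] /asboolP[c yc]]; apply/asboolP.
  by exists 0; rewrite mul0r.
by exists (a * b + c); rewrite xb yc mulrDl -mulrA.
Qed.
HB.instance Definition _ :=
  GRing.isSubmodClosed.Build A A^o in_lideal in_lideal_closed.

Record lideal := LIdeal { lval : A^o; _ : in_lideal lval }.
HB.instance Definition _ := [isSub for lval].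
HB.instance Definition _ := [Choice of lideal by <:].
HB.instance Definition _ := [SubChoice_isSubLmodule of lideal by <:].

Lemma lidealP (x : lideal) : exists a : A, lval x = a * e :> A.
Proof. by case: x => x /= /asboolP. Qed.

Lemma lval_linear : linear lval.
Proof. exact: (linearP (\val : lideal -> A^o)). Qed.
HB.instance Definition _ := GRing.isLinear.Build A lideal A^o *:%R lval lval_linear.

Lemma lval_inj : injective lval.
Proof. exact: val_inj. Qed.

Lemma lideal_gen_proof : in_lideal (e : A^o).
Proof. by apply/asboolP; exists 1; rewrite mul1r. Qed.
Definition lideal_gen : lideal := LIdeal lideal_gen_proof.

Lemma lideal_fg : fin_gen lideal.
Proof.
exists unit, (fun _ => lideal_gen) => x; have [a ha] := lidealP x.
exists (fun _ => a); apply: lval_inj; rewrite linear_sum.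
by rewrite (bigD1 tt) //= big1 ?addr0 ?linearZ //= => -[].
Qed.

Hypothesis ee : e * e = e.

Lemma lidealE (x : lideal) : (lval x : A) * e = lval x.
Proof. by have [a ->] := lidealP x; rewrite -mulrA ee. Qed.

Lemma lideal_projective : projective lideal.
Proof.
move=> X Y g f surj; have [x0 hx0] := surj (f lideal_gen).
pose h (x : lideal) : X := (lval x : A) *: x0.
have hl : linear h.
  by move=> a x y; rewrite /h linearP /= scalerDl -scalerA.
pose H : {linear lideal -> X} := HB.pack h (GRing.isLinear.Build A lideal X *:%R h hl).
exists H => x; rewrite -[H x]/((lval x : A) *: x0) linearZ /= hx0 -linearZ.
congr (f _); apply: lval_inj; rewrite linearZ /=.
exact: lidealE.
Qed.
End LeftIdeal.

Section RightMul.
Variables (e e' a : A).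
Hypothesis ae' : a * e' = a.

Lemma rmul_proof (x : lideal e) : in_lideal e' ((lval x : A) * a : A^o).
Proof. by apply/asboolP; exists ((lval x : A) * a); rewrite -mulrA ae'. Qed.
Definition lideal_rmul (x : lideal e) : lideal e' := LIdeal (rmul_proof x).

Lemma lideal_rmul_linear : linear lideal_rmul.
Proof.
move=> b x y; apply: lval_inj; rewrite [RHS]linearP.
by rewrite -[LHS]/((lval (b *: x + y) : A) * a) linearP mulrDl -mulrA.
Qed.
End RightMul.

Section Product.
Variables (J : finType) (M : J -> lmodType A).

Definition dprod : Type := forall j, M j.
HB.instance Definition _ := gen_eqMixin dprod.
HB.instance Definition _ := gen_choiceMixin dprod.

Implicit Types x y z : dprod.
Definition dprod0 : dprod := fun=> 0.
Definition dprodN x : dprod := fun j => - x j.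
Definition dprodD x y : dprod := fun j => x j + y j.
Definition dprodZ (a : A) x : dprod := fun j => a *: x j.

Lemma dprodP x y : (forall j, x j = y j) -> x = y.
Proof. exact: functional_extensionality_dep. Qed.

Fact dprod_addA : associative dprodD.
Proof. by move=> x y z; apply: dprodP => j; apply: addrA. Qed.
Fact dprod_addC : commutative dprodD.
Proof. by move=> x y; apply: dprodP => j; apply: addrC. Qed.
Fact dprod_add0 : left_id dprod0 dprodD.
Proof. by move=> x; apply: dprodP => j; apply: add0r. Qed.
Fact dprod_addN : left_inverse dprod0 dprodN dprodD.
Proof. by move=> x; apply: dprodP => j; apply: addNr. Qed.
HB.instance Definition _ :=
  GRing.isZmodule.Build dprod dprod_addA dprod_addC dprod_add0 dprod_addN.

Fact dprod_scaleA a b x : dprodZ a (dprodZ b x) = dprodZ (a * b) x.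
Proof. by apply: dprodP => j; apply: scalerA. Qed.
Fact dprod_scale1 : left_id 1 dprodZ.
Proof. by move=> x; apply: dprodP => j; apply: scale1r. Qed.
Fact dprod_scaleDr : right_distributive dprodZ +%R.
Proof. by move=> a x y; apply: dprodP => j; apply: scalerDr. Qed.
Fact dprod_scaleDl x : {morph dprodZ^~ x : a b / a + b}.
Proof. by move=> a b; apply: dprodP => j; apply: scalerDl. Qed.
HB.instance Definition _ := GRing.Zmodule_isLmodule.Build A dprod
  dprod_scaleA dprod_scale1 dprod_scaleDr dprod_scaleDl.

Lemma dprod_linE a x y j : (a *: x + y : dprod) j = a *: x j + y j.
Proof. by []. Qed.

Definition dproj (j : J) x : M j := x j.
Lemma dproj_linear j : linear (dproj j). Proof. by []. Qed.
HB.instance Definition _ j :=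
  GRing.isLinear.Build A dprod (M j) *:%R (dproj j) (dproj_linear j).

Definition dinj (j : J) (u : M j) : dprod :=
  @dfwith J (fun k => M k) (fun=> 0) j u.

Lemma dinjE j (u : M j) : dinj u j = u.
Proof. by rewrite /dinj dfwith_in. Qed.
Lemma dinj_out j k (u : M j) : j != k -> dinj u k = 0.
Proof. by move=> ne; rewrite /dinj dfwith_out. Qed.

Lemma dinj_linear j : linear (@dinj j).
Proof.
move=> a u v; apply: dprodP => k.
rewrite -[RHS]/(a *: dinj u k + dinj v k).
have [<-|ne] := eqVneq j k; first by rewrite !dinjE.
by rewrite !(dinj_out _ ne) scaler0 addr0.
Qed.
HB.instance Definition _ j :=
  GRing.isLinear.Build A (M j) dprod *:%R (@dinj j) (@dinj_linear j).

Lemma dprod_sumE (T : Type) (s : seq T) (P : pred T) (F : T -> dprod) j :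
  (\sum_(t <- s | P t) F t) j = \sum_(t <- s | P t) F t j.
Proof. by rewrite -[LHS]/(dproj j _) linear_sum. Qed.

Lemma dprodE x : x = \sum_j dinj (x j).
Proof.
apply: dprodP => k; rewrite dprod_sumE (bigD1 k) //= dinjE big1 ?addr0 //.
by move=> j ne; rewrite dinj_out.
Qed.

Lemma dprod_fg : (forall j, fin_gen (M j)) -> fin_gen dprod.
Proof.
move=> h; pose T j : finType := projT1 (cid (h j)).
have hT j : exists v : T j -> M j, forall x : M j, exists c : T j -> A,
    x = \sum_t c t *: v t by exact: (projT2 (cid (h j))).
pose v j := projT1 (cid (hT j)); have hv j := projT2 (cid (hT j)).
exists {j & T j}, (fun t => dinj (v (tag t) (tagged t))) => x.
pose c j := projT1 (cid (hv j (x j))); have hc j := projT2 (cid (hv j (x j))).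
exists (fun t => c (tag t) (tagged t)); rewrite [LHS]dprodE.
rewrite (eq_bigr (fun j => \sum_(t : T j) c j t *: dinj (v j t))); last first.
  move=> j _; rewrite [x j](hc j) linear_sum; apply: eq_bigr => t _.
  by rewrite linearZ.
rewrite (sig_big_dep (fun=> true) (fun _ _ => true)
  (fun j t => c j t *: dinj (v j t))).
by apply: eq_bigl => -[].
Qed.

Lemma dprod_projective : (forall j, projective (M j)) -> projective dprod.
Proof.
move=> h X Y g f surj.
have hj j : exists hh : {linear M j -> X}, forall m, g (hh m) = f (dinj m).
  exact: (h j X Y g (f \o @dinj j)).
pose hh j := projT1 (cid (hj j)); have hhP j := projT2 (cid (hj j)).
pose H (x : dprod) : X := \sum_j hh j (x j).
have lH : linear H.
  move=> a x y; rewrite /H scaler_sumr -big_split; apply: eq_bigr => j _.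
  by rewrite dprod_linE linearP.
pose HL : {linear dprod -> X} := HB.pack H (GRing.isLinear.Build A dprod X *:%R H lH).
exists HL => x; rewrite -[HL x]/(\sum_j hh j (x j)) linear_sum [in RHS](dprodE x).
by rewrite linear_sum; apply: eq_bigr => j _; rewrite hhP.
Qed.
End Product.
End LeftModules.

Section GradedModules.
Variables (K : fieldType) (A : algType K).
Variable Agr : int * int -> A -> Prop.

(* A bigraded left module: an A-module which is the internal direct sum of the
   subgroups gr d, d in Z^2, with A_d M_e contained in M_(d+e). *)
Record gmod := GMod {
  gm_mod :> lmodType A;
  gr : int * int -> gm_mod -> Prop;
  gr0 : forall d, gr d 0;
  grB : forall d x y, gr d x -> gr d y -> gr d (x - y);
  grM : forall d e a x, Agr d a -> gr e x -> gr (d + e) (a *: x);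
  gr_span : forall x, exists s : seq gm_mod,
    (forall y, y \in s -> exists d, gr d y) /\ x = \sum_(y <- s) y;
  gr_direct : forall (s : seq (int * int)) (c : int * int -> gm_mod),
    uniq s -> (forall d, gr d (c d)) -> \sum_(d <- s) c d = 0 ->
    forall d, d \in s -> c d = 0 }.

Lemma grN (M : gmod) d (x : M) : gr d x -> gr d (- x).
Proof. by move=> h; rewrite -sub0r; apply: grB => //; apply: gr0. Qed.

Lemma grD (M : gmod) d (x y : M) : gr d x -> gr d y -> gr d (x + y).
Proof. by move=> hx hy; rewrite -[y]opprK; apply: grB => //; apply: grN. Qed.

Lemma gr_sum (M : gmod) d (T : Type) (s : seq T) (P : pred T) (F : T -> M) :
  (forall t, P t -> gr d (F t)) -> gr d (\sum_(t <- s | P t) F t).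
Proof.
by move=> h; apply: (big_ind (gr d)) => //; [apply: gr0|apply: grD].
Qed.

Record gmhom (M N : gmod) := GMHom {
  gh_fun :> M -> N;
  gh_linear : linear gh_fun;
  gh_gr : forall d x, gr d x -> gr d (gh_fun x) }.
HB.instance Definition _ M N (f : gmhom M N) :=
  GRing.isLinear.Build A M N *:%R (gh_fun f) (gh_linear f).

Section HomGroup.
Variables M N : gmod.
HB.instance Definition _ := gen_eqMixin (gmhom M N).
HB.instance Definition _ := gen_choiceMixin (gmhom M N).
Implicit Types f g h : gmhom M N.

Lemma gmhomP f g : (forall x, f x = g x) -> f = g.
Proof.
case: f g => [f f1 f2] [g g1 g2] /= /funext e; rewrite -{}e in g1 g2 *.
by congr GMHom; apply: Prop_irrelevance.
Qed.

Definition gh0 : gmhom M N.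
Proof.
exists (fun=> 0) => [a x y|d x _]; first by rewrite scaler0 addr0.
exact: gr0.
Defined.
Definition ghN f : gmhom M N.
Proof.
exists (fun x => - f x) => [a x y|d x h]; first by rewrite linearP opprD scalerN.
exact/grN/gh_gr.
Defined.
Definition ghD f g : gmhom M N.
Proof.
exists (fun x => f x + g x) => [a x y|d x h].
  by rewrite !linearP scalerDr addrACA.
by apply: grD; apply: gh_gr.
Defined.
Fact ghDA : associative ghD.
Proof. by move=> f g h; apply: gmhomP => x; apply: addrA. Qed.
Fact ghDC : commutative ghD.
Proof. by move=> f g; apply: gmhomP => x; apply: addrC. Qed.
Fact gh0D : left_id gh0 ghD.
Proof. by move=> f; apply: gmhomP => x; apply: add0r. Qed.
Fact ghND : left_inverse gh0 ghN ghD.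
Proof. by move=> f; apply: gmhomP => x; apply: addNr. Qed.
HB.instance Definition _ := GRing.isZmodule.Build (gmhom M N) ghDA ghDC gh0D ghND.

Lemma ghDE f g x : (f + g) x = f x + g x. Proof. by []. Qed.
Lemma ghBE f g x : (f - g) x = f x - g x. Proof. by []. Qed.

Lemma gh_sumE (T : Type) (s : seq T) (P : pred T) (F : T -> gmhom M N) x :
  (\sum_(t <- s | P t) F t) x = \sum_(t <- s | P t) F t x.
Proof. by elim/big_rec2: _ => // t y f _ <-. Qed.
End HomGroup.

Definition gh_id (M : gmod) : gmhom M M.
Proof. by exists id. Defined.

Definition gh_comp (L M N : gmod) (g : gmhom M N) (f : gmhom L M) : gmhom L N.
Proof.
exists (g \o f) => [a x y|d x h] /=; first by rewrite !linearP.
by do 2!apply: gh_gr.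
Defined.

Lemma gh_comp1l (M N : gmod) (f : gmhom M N) : gh_comp (gh_id N) f = f.
Proof. exact: gmhomP. Qed.
Lemma gh_comp1r (M N : gmod) (f : gmhom M N) : gh_comp f (gh_id M) = f.
Proof. exact: gmhomP. Qed.

Definition gm_iso (M N : gmod) : Prop :=
  exists (f : gmhom M N) (g : gmhom N M), cancel f g /\ cancel g f.

(* M<k>{l}, for d = (k, l): an element of bidegree e of M gets bidegree e + d. *)
Definition gm_shift (d : int * int) (M : gmod) : gmod.
Proof.
refine (@GMod M (fun e => gr (e - d)) _ _ _ _ _) => [e|e x y|e e' a x|x|s c us hc sc].
- exact: gr0.
- exact: grB.
- by move=> ha hx; rewrite -addrA; apply: grM.
- have [s [hs xs]] := gr_span x; exists s; split=> // y /hs[e he].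
  by exists (e + d); rewrite addrK.
pose c' e := c (e + d).
have us' : uniq [seq e - d | e <- s] by rewrite map_inj_uniq //; apply: addIr.
have hc' e : gr e (c' e) by have := hc (e + d); rewrite addrK.
have sc' : \sum_(e <- [seq e - d | e <- s]) c' e = 0.
  by rewrite big_map -[RHS]sc; apply: eq_bigr => e _; rewrite /c' subrK.
move=> e es; have := gr_direct us' hc' sc' (map_f _ es).
by rewrite /c' subrK.
Defined.

Section DirectSum.
Variables (J : finType) (M : J -> gmod).

Definition gm_sum : gmod.
Proof.
refine (@GMod (dprod M) (fun d x => forall j, gr d (x j)) _ _ _ _ _)
  => [d j|d x y hx hy j|d e a x ha hx j|x|s c us hc sc d ds].
- exact: gr0.
- exact: grB.
- exact: grM.
- pose s j := projT1 (cid (gr_span (x j))); have hs j := projT2 (cid (gr_span (x j))).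
  exists (flatten [seq [seq dinj y | y <- s j] | j <- enum J]); split.
    move=> y /flattenP[t /mapP[j _ ->] /mapP[z /(proj1 (hs j))[d hd] ->]].
    exists d => k; have [<-|ne] := eqVneq j k; first by rewrite dinjE.
    by rewrite dinj_out //; apply: gr0.
  rewrite big_flatten big_map big_enum [LHS]dprodE; apply: eq_bigr => j _.
  by rewrite big_map [x j](proj2 (hs j)) linear_sum.
- apply: dprodP => j; apply: (@gr_direct (M j) s (fun e => c e j)) => //.
  by have := congr1 (fun z : dprod M => z j) sc; rewrite dprod_sumE.
Defined.

Definition gh_proj (j : J) : gmhom gm_sum (M j).
Proof. by exists (@dproj _ _ J M j) => [|d x h]; [exact: linearP|exact: h]. Defined.

Definition gh_inj (j : J) : gmhom (M j) gm_sum.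
Proof.
exists (@dinj _ _ _ M j) => [|d x h k]; first exact: linearP.
have [<-|ne] := eqVneq j k; first by rewrite dinjE.
by rewrite dinj_out //; apply: gr0.
Defined.
End DirectSum.

Definition gh_sum (J : finType) (M N : J -> gmod) (f : forall j, gmhom (M j) (N j)) :
  gmhom (gm_sum M) (gm_sum N).
Proof.
exists (fun x j => f j (x j)) => [a x y|d x h j]; last exact/gh_gr/h.
by apply: dprodP => j; rewrite linearP.
Defined.

Lemma gh_sum_inj (J : finType) (M N : J -> gmod)
    (f : forall j, gmhom (M j) (N j)) j (z : M j) :
  gh_sum f (gh_inj M j z) = gh_inj N j (f j z).
Proof.
apply: dprodP => k; rewrite /=.
have [<-|ne] := eqVneq j k; first by rewrite !dinjE.
by rewrite !(dinj_out _ ne) linear0.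
Qed.

(* M (x)_K V, for V of finite dimension, as the direct sum of dim V copies of
   M: the family (x_k)_k stands for the sum of the x_k (x) b_k, where (b_k)_k is
   the basis vbasis {:V}; see tens_pure, tensE and gh_tens_pure. *)
Definition gm_tens (M : gmod) (V : vectType K) : gmod :=
  gm_sum (fun _ : 'I_(\dim {:V}) => M).

Definition tens_pure (M : gmod) (V : vectType K) (x : M) (v : V) : gm_tens M V :=
  fun k => (coord (vbasis {:V}) k v)%:A *: x.

Lemma tensE (M : gmod) (V : vectType K) (x : gm_tens M V) :
  x = \sum_k tens_pure (x k) (vbasis {:V})`_k.
Proof.
apply: dprodP => l; rewrite dprod_sumE (bigD1 l) //= /tens_pure.
rewrite coord_free ?(basis_free (vbasisP _)) // eqxx scale1r scale1r.
rewrite big1 ?addr0 // => k ne.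
by rewrite coord_free ?(basis_free (vbasisP _)) // (negbTE ne) !scale0r.
Qed.

(* the matrix of g in the chosen bases *)
Definition lfun_coef (V W : vectType K) (g : 'Hom(V, W))
    (l : 'I_(\dim {:W})) (k : 'I_(\dim {:V})) : K :=
  coord (vbasis {:W}) l (g (vbasis {:V})`_k).

Lemma lfun_coefP (V W : vectType K) (g : 'Hom(V, W)) l v :
  \sum_k lfun_coef g l k * coord (vbasis {:V}) k v = coord (vbasis {:W}) l (g v).
Proof.
rewrite {2}(coord_vbasis (memvf v)) !linear_sum; apply: eq_bigr => k _.
by rewrite !linearZ /= mulrC.
Qed.

Lemma lfun_coef_id (V : vectType K) l k :
  lfun_coef (\1%VF : 'Hom(V, V)) l k = (k == l)%:R.
Proof. by rewrite /lfun_coef id_lfunE coord_free ?(basis_free (vbasisP _)). Qed.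

Lemma lfun_coef_comp (U V W : vectType K) (g : 'Hom(V, W)) (f : 'Hom(U, V)) l k :
  lfun_coef (g \o f)%VF l k = \sum_m lfun_coef g l m * lfun_coef f m k.
Proof. by rewrite /lfun_coef comp_lfunE lfun_coefP. Qed.

Lemma alg_comm (a : A) (k : K) : a * k%:A = k%:A * a.
Proof. by rewrite mulr_algr mulr_algl. Qed.

Section TensorMaps.
Hypothesis Agr_scalar : forall k : K, Agr 0 k%:A.
Variables (V W : vectType K) (M N : gmod).

Definition gh_tens (f : gmhom M N) (g : 'Hom(V, W)) :
  gmhom (gm_tens M V) (gm_tens N W).
Proof.
exists (fun x l => \sum_k (lfun_coef g l k)%:A *: f (x k)) => [a x y|d x h l].
  apply: dprodP => l; rewrite dprod_linE scaler_sumr -big_split.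
  apply: eq_bigr => k _ /=.
  rewrite dprod_linE linearP scalerDr !scalerA.
  by rewrite alg_comm.
apply: gr_sum => k _; rewrite -[d]add0r; apply: grM; first exact: Agr_scalar.
exact/gh_gr/h.
Defined.

Lemma gh_tensE (f : gmhom M N) (g : 'Hom(V, W)) (x : gm_tens M V) l :
  (gh_tens f g x : gm_tens N W) l = \sum_k (lfun_coef g l k)%:A *: f (x k).
Proof. by []. Qed.

Lemma gh_tens_pure (f : gmhom M N) (g : 'Hom(V, W)) x v :
  gh_tens f g (tens_pure x v) = tens_pure (f x) (g v).
Proof.
apply: dprodP => l; rewrite /= /tens_pure -lfun_coefP scaler_suml.
rewrite scaler_suml; apply: eq_bigr => k _.
by rewrite linearZ /= scalerA -scalerAl mul1r scalerA.
Qed.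
End TensorMaps.

Section TensorFunctor.
Hypothesis Agr_scalar : forall k : K, Agr 0 k%:A.
Variables (U V W : vectType K) (L M N : gmod).

Lemma gh_tens_id : gh_tens Agr_scalar (gh_id M) \1%VF = gh_id (gm_tens M V).
Proof.
apply: gmhomP => x; apply: dprodP => l /=; rewrite (bigD1 l) //= big1 => [|k ne].
  by rewrite lfun_coef_id eqxx scale1r scale1r addr0.
by rewrite lfun_coef_id (negbTE ne) !scale0r.
Qed.

Lemma gh_tens_comp (f' : gmhom M N) (f : gmhom L M) (g' : 'Hom(V, W)) (g : 'Hom(U, V)) :
  gh_tens Agr_scalar (gh_comp f' f) (g' \o g)%VF =
  gh_comp (gh_tens Agr_scalar f' g') (gh_tens Agr_scalar f g).
Proof.
apply: gmhomP => x; apply: dprodP => l /=.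
under [RHS]eq_bigr => k _ do rewrite linear_sum scaler_sumr.
rewrite exchange_big; apply: eq_bigr => k _ /=.
rewrite lfun_coef_comp !scaler_suml; apply: eq_bigr => m _.
by rewrite linearZ /= scalerA -scalerAl mul1r scalerA.
Qed.

Lemma gh_tens_idE (x : gm_tens M V) :
  gh_tens Agr_scalar (gh_id M) \1%VF x = x.
Proof. by rewrite gh_tens_id. Qed.

Lemma gh_tens_compE (f' : gmhom M N) (f : gmhom L M) (g' : 'Hom(V, W))
    (g : 'Hom(U, V)) x :
  gh_tens Agr_scalar (gh_comp f' f) (g' \o g)%VF x =
  gh_tens Agr_scalar f' g' (gh_tens Agr_scalar f g x).
Proof. by rewrite gh_tens_comp. Qed.
End TensorFunctor.
End GradedModules.

Record precat := PreCat {
  ob :> Type;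
  hom : ob -> ob -> zmodType;
  idc : forall X, hom X X;
  compc : forall X Y Z, hom Y Z -> hom X Y -> hom X Z;
  comp1c : forall X Y (f : hom X Y), compc (idc Y) f = f;
  compc1 : forall X Y (f : hom X Y), compc f (idc X) = f;
  compcA : forall W X Y Z (h : hom Y Z) (g : hom X Y) (f : hom W X),
    compc h (compc g f) = compc (compc h g) f;
  compcDl : forall X Y Z (g g' : hom Y Z) (f : hom X Y),
    compc (g + g') f = compc g f + compc g' f;
  compcDr : forall X Y Z (g : hom Y Z) (f f' : hom X Y),
    compc g (f + f') = compc g f + compc g f' }.
Arguments hom {p} X Y.
Arguments idc {p} X.
Arguments compc {p X Y Z} g f.
Notation "g \oc f" := (compc g f) (at level 40, left associativity).

Section Categories.
Variable C : precat.

Definition is_iso (X Y : C) (f : hom X Y) : Prop :=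
  exists g : hom Y X, g \oc f = idc X /\ f \oc g = idc Y.

Definition isomorphic (X Y : C) : Prop := exists f : hom X Y, is_iso f.

Definition is_zero (Z : C) : Prop :=
  forall X, (forall f : hom X Z, f = 0) /\ (forall f : hom Z X, f = 0).

Definition is_biproduct (X Y S : C) (i : hom X S) (j : hom Y S)
    (p : hom S X) (q : hom S Y) : Prop :=
  [/\ p \oc i = idc X, q \oc j = idc Y, p \oc j = 0, q \oc i = 0
    & i \oc p + j \oc q = idc S].

Definition monic (X Y : C) (f : hom X Y) : Prop :=
  forall W (g h : hom W X), f \oc g = f \oc h -> g = h.

Definition epic (X Y : C) (f : hom X Y) : Prop :=
  forall Z (g h : hom Y Z), g \oc f = h \oc f -> g = h.

Definition is_kernel (X Y N : C) (f : hom X Y) (k : hom N X) : Prop :=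
  f \oc k = 0 /\
  forall W (h : hom W X), f \oc h = 0 -> exists! u : hom W N, k \oc u = h.

Definition is_cokernel (X Y Q : C) (f : hom X Y) (c : hom Y Q) : Prop :=
  c \oc f = 0 /\
  forall Z (h : hom Y Z), h \oc f = 0 -> exists! u : hom Q Z, u \oc c = h.

Record abelian : Prop := Abelian {
  ab_zero : exists Z : C, is_zero Z;
  ab_biproduct : forall X Y : C, exists S i j p q, @is_biproduct X Y S i j p q;
  ab_kernel : forall (X Y : C) (f : hom X Y),
    exists N (k : hom N X), is_kernel f k;
  ab_cokernel : forall (X Y : C) (f : hom X Y),
    exists Q (c : hom Y Q), is_cokernel f c;
  ab_monic : forall (X Y : C) (f : hom X Y), monic f ->
    exists Z (g : hom Y Z), is_kernel g f;
  ab_epic : forall (X Y : C) (f : hom X Y), epic f ->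
    exists W (g : hom W X), is_cokernel g f }.

Definition full_subcat (P : C -> Prop) : precat.
Proof.
refine (@PreCat {X : C | P X} (fun X Y => hom (sval X) (sval Y))
  (fun X => idc (sval X)) (fun X Y Z g f => g \oc f) _ _ _ _ _).
- by move=> X Y f; apply: comp1c.
- by move=> X Y f; apply: compc1.
- by move=> W X Y Z h g f; apply: compcA.
- by move=> X Y Z g g' f; apply: compcDl.
- by move=> X Y Z g f f'; apply: compcDr.
Defined.
End Categories.

Record functor (C D : precat) := Functor {
  fob :> C -> D;
  fhom : forall X Y, hom X Y -> hom (fob X) (fob Y);
  fhom_id : forall X, fhom (idc X) = idc (fob X);
  fhom_comp : forall X Y Z (g : hom Y Z) (f : hom X Y),
    fhom (g \oc f) = fhom g \oc fhom f }.
Arguments fhom {C D} F {X Y} : rename.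

Definition functor_id (C : precat) : functor C C.
Proof. by exists id (fun _ _ f => f). Defined.

Definition functor_comp (C D E : precat) (G : functor D E) (F : functor C D) :
  functor C E.
Proof.
exists (fun X => G (F X)) (fun X Y f => fhom G (fhom F f)).
- by move=> X; rewrite !fhom_id.
- by move=> X Y Z g f; rewrite !fhom_comp.
Defined.

Definition nat_isomorphic (C D : precat) (F G : functor C D) : Prop :=
  exists eta : forall X, hom (F X) (G X),
    (forall X, is_iso (eta X)) /\
    forall X Y (f : hom X Y), eta Y \oc fhom F f = fhom G f \oc eta X.

Definition additive_functor (C D : precat) (F : functor C D) : Prop :=
  forall X Y (f g : hom X Y), fhom F (f + g) = fhom F f + fhom F g.

Definition equivalence (C D : precat) (F : functor C D) : Prop :=
  exists G : functor D C,
    nat_isomorphic (functor_comp G F) (functor_id C) /\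
    nat_isomorphic (functor_comp F G) (functor_id D).

Definition abelian_equivalence (C D : precat) (F : functor C D) : Prop :=
  [/\ abelian C, abelian D, additive_functor F & equivalence F].

Definition corestrict (C D : precat) (F : functor C D) (P : D -> Prop)
    (h : forall X, P (F X)) : functor C (full_subcat P).
Proof.
exists (fun X => exist P (F X) (h X) : full_subcat P) (fun X Y f => fhom F f).
- by move=> X; apply: fhom_id.
- by move=> X Y Z g f; apply: fhom_comp.
Defined.

Section Complexes.
Variables (K : fieldType) (A : algType K) (Agr : int * int -> A -> Prop).

Record cplx := Cplx {
  cterm :> int -> gmod Agr;
  cdiff : forall n, gmhom (cterm n) (cterm (n + 1));
  cdiff2 : forall n x, cdiff (n + 1) (cdiff n x) = 0;
  cterm_fg : forall n, fin_gen (cterm n);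
  cterm_proj : forall n, projective (cterm n);
  cterm_bounded : exists N : nat, forall n : int, (N < `|n|)%N ->
    forall x : cterm n, x = 0 }.

Record chmap (X Y : cplx) := ChMap {
  ch_fun :> forall n, gmhom (X n) (Y n);
  ch_comm : forall n x, ch_fun (n + 1) (cdiff X n x) = cdiff Y n (ch_fun n x) }.

Section ChainMapGroup.
Variables X Y : cplx.
HB.instance Definition _ := gen_eqMixin (chmap X Y).
HB.instance Definition _ := gen_choiceMixin (chmap X Y).
Implicit Types f g h : chmap X Y.

Lemma chmapP f g : (forall n x, f n x = g n x) -> f = g.
Proof.
case: f g => [f hf] [g hg] /= e.
have {}e : f = g.
  by apply: functional_extensionality_dep => n; apply: gmhomP => x; apply: e.
rewrite -{}e in hg *; congr ChMap; exact: Prop_irrelevance.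
Qed.

Definition ch0 : chmap X Y.
Proof. by exists (fun=> 0) => n x; rewrite [RHS]linear0. Defined.
Definition chN f : chmap X Y.
Proof.
exists (fun n => - f n) => n x.
by rewrite [LHS]/= ch_comm -[RHS]/(cdiff Y n (- f n x)) linearN.
Defined.
Definition chD f g : chmap X Y.
Proof.
exists (fun n => f n + g n) => n x.
by rewrite [LHS]/= !ch_comm -[RHS]/(cdiff Y n (f n x + g n x)) linearD.
Defined.
Fact chDA : associative chD.
Proof. by move=> f g h; apply: chmapP => n x; apply: addrA. Qed.
Fact chDC : commutative chD.
Proof. by move=> f g; apply: chmapP => n x; apply: addrC. Qed.
Fact ch0D : left_id ch0 chD.
Proof. by move=> f; apply: chmapP => n x; apply: add0r. Qed.
Fact chND : left_inverse ch0 chN chD.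
Proof. by move=> f; apply: chmapP => n x; apply: addNr. Qed.
HB.instance Definition _ := GRing.isZmodule.Build (chmap X Y) chDA chDC ch0D chND.

Lemma chDE f g n x : (f + g) n x = f n x + g n x. Proof. by []. Qed.
Lemma chBE f g n x : (f - g) n x = f n x - g n x. Proof. by []. Qed.
Lemma ch0E n x : (0 : chmap X Y) n x = 0. Proof. by []. Qed.
End ChainMapGroup.

Definition ch_id (X : cplx) : chmap X X.
Proof. by exists (fun n => gh_id (X n)). Defined.

Definition ch_comp (X Y Z : cplx) (g : chmap Y Z) (f : chmap X Y) : chmap X Z.
Proof. by exists (fun n => gh_comp (g n) (f n)) => n x /=; rewrite !ch_comm. Defined.

Definition Chain : precat.
Proof.
refine (@PreCat cplx chmap ch_id ch_comp _ _ _ _ _).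
- by move=> X Y f; apply: chmapP.
- by move=> X Y f; apply: chmapP.
- by move=> W X Y Z h g f; apply: chmapP.
- by move=> X Y Z g g' f; apply: chmapP.
- by move=> X Y Z g f f'; apply: chmapP => n x; apply: (linearD (g n)).
Defined.

(* In degree n + 1, f = d h + h d, where h n : X (n + 1) -> Y n. *)
Definition null_homotopic (X Y : cplx) (f : chmap X Y) : Prop :=
  exists h : forall n, gmhom (X (n + 1)) (Y n),
    forall n x, f (n + 1) x = cdiff Y n (h n x) + h (n + 1) (cdiff X (n + 1) x).

Definition null_homotopicb (X Y : cplx) (f : chmap X Y) : bool :=
  `[< null_homotopic f >].

Lemma null_homotopic_closed X Y : zmod_closed (@null_homotopicb X Y).
Proof.
split=> [|f g /asboolP[h hh] /asboolP[k hk]]; apply/asboolP.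
  by exists (fun=> 0) => n x; rewrite ch0E !linear0 addr0.
exists (fun n => h n - k n) => n x; rewrite chBE hh hk.
by rewrite !ghBE linearB /= opprD addrACA.
Qed.
HB.instance Definition _ X Y := GRing.isZmodClosed.Build (chmap X Y)
  (@null_homotopicb X Y) (@null_homotopic_closed X Y).

Lemma null_homotopicD X Y (f g : chmap X Y) :
  null_homotopic f -> null_homotopic g -> null_homotopic (f + g).
Proof.
move=> [h hh] [k hk]; exists (fun n => h n + k n) => n x; rewrite chDE hh hk.
by rewrite !ghDE linearD /= addrACA.
Qed.

Lemma null_homotopicl X Y Z (g : chmap Y Z) (f : chmap X Y) :
  null_homotopic f -> null_homotopic (ch_comp g f).
Proof.
move=> [h hh]; exists (fun n => gh_comp (g n) (h n)) => n x.
by rewrite /= hh linearD /= ch_comm.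
Qed.

Lemma null_homotopicr X Y Z (g : chmap Y Z) (f : chmap X Y) :
  null_homotopic g -> null_homotopic (ch_comp g f).
Proof.
move=> [h hh]; exists (fun n => gh_comp (h n) (f (n + 1))) => n x.
by rewrite /= hh ch_comm.
Qed.

Definition htmap (X Y : cplx) : Type :=
  Quotient.quot (GRing.ZmodClosed.clone (chmap X Y) (@null_homotopicb X Y) _).
HB.instance Definition _ X Y := ZmodQuotient.on (htmap X Y).

Definition htpi (X Y : cplx) (f : chmap X Y) : htmap X Y := \pi_(htmap X Y) f.

Lemma htpi_eq X Y (f g : chmap X Y) : htpi f = htpi g <-> null_homotopic (f - g).
Proof.
split=> [/eqP|h]; last apply/eqP.
  by rewrite -Quotient.idealrBE => /asboolP.
by rewrite -Quotient.idealrBE; apply/asboolP.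
Qed.

Lemma htpiB X Y : zmod_morphism (@htpi X Y).
Proof. by move=> f g; rewrite /htpi raddfB. Qed.
HB.instance Definition _ X Y :=
  GRing.isZmodMorphism.Build (chmap X Y) (htmap X Y) (@htpi X Y) (@htpiB X Y).

Lemma htpiK X Y (f : htmap X Y) : htpi (repr f) = f.
Proof. exact: reprK. Qed.

Definition ht_comp (X Y Z : cplx) (g : htmap Y Z) (f : htmap X Y) : htmap X Z :=
  htpi (ch_comp (repr g) (repr f)).

Lemma ht_compE X Y Z (g : chmap Y Z) (f : chmap X Y) :
  ht_comp (htpi g) (htpi f) = htpi (ch_comp g f).
Proof.
rewrite /ht_comp htpi_eq; set g' := repr _; set f' := repr _.
have hg : null_homotopic (g' - g) by rewrite -htpi_eq htpiK.
have hf : null_homotopic (f' - f) by rewrite -htpi_eq htpiK.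
have -> : ch_comp g' f' - ch_comp g f =
    ch_comp (g' - g) f' + ch_comp g (f' - f).
  apply: chmapP => n x; rewrite [LHS]chBE [RHS]chDE.
  rewrite -[ch_comp (g' - g) f' n x]/(g' n (f' n x) - g n (f' n x)).
  rewrite -[ch_comp g (f' - f) n x]/(g n (f' n x - f n x)) linearB /=.
  by rewrite addrA subrK.
by apply: null_homotopicD; [apply: null_homotopicr|apply: null_homotopicl].
Qed.

Definition Ho : precat.
Proof.
refine (@PreCat cplx htmap (fun X => htpi (ch_id X)) ht_comp _ _ _ _ _).
- move=> X Y f; rewrite -(htpiK f) ht_compE; congr htpi; exact: chmapP.
- move=> X Y f; rewrite -(htpiK f) ht_compE; congr htpi; exact: chmapP.
- move=> W X Y Z h g f; rewrite -(htpiK f) -(htpiK g) -(htpiK h) !ht_compE.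
  congr htpi; exact: chmapP.
- move=> X Y Z g g' f; rewrite -(htpiK f) -(htpiK g) -(htpiK g').
  rewrite -raddfD !ht_compE -raddfD; congr htpi; exact: chmapP.
- move=> X Y Z g f f'; rewrite -(htpiK f) -(htpiK g) -(htpiK f').
  rewrite -raddfD !ht_compE -raddfD; congr htpi.
  by apply: chmapP => n x; apply: (linearD (repr g n)).
Defined.

Definition contractible (X : cplx) : Prop := null_homotopic (ch_id X).

Definition minimal (M : cplx) : Prop :=
  forall (X Y : Chain) (i : hom X (M : Chain)) (j : hom Y (M : Chain)) p q,
    is_biproduct i j p q -> contractible X -> is_zero X.
End Complexes.

Section Representations.
Variables (K : fieldType) (G : ade_quiver).

Definition arrows : finType := {a : G * G | arrow a.1 a.2}.
Definition asrc (a : arrows) : G := (val a).1.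
Definition atgt (a : arrows) : G := (val a).2.
Definition aarrow (a : arrows) : arrow (asrc a) (atgt a) := valP a.

Record grep := GRep {
  rspace :> G -> int -> vectType K;
  rmap : forall (a : arrows) (m : int),
    'Hom(rspace (asrc a) m, rspace (atgt a) (m + 1));
  rfin : exists N : nat, forall i (m : int), (N < `|m|)%N ->
    \dim {: rspace i m} = 0%N }.

Record rephom (V W : grep) := RepHom {
  rh :> forall i m, 'Hom(V i m, W i m);
  rh_comm : forall (a : arrows) m,
    (rh (atgt a) (m + 1) \o rmap V a m)%VF = (rmap W a m \o rh (asrc a) m)%VF }.

Section RepHomGroup.
Variables V W : grep.
HB.instance Definition _ := gen_eqMixin (rephom V W).
HB.instance Definition _ := gen_choiceMixin (rephom V W).
Implicit Types f g h : rephom V W.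

Lemma rephomP f g : (forall i m, f i m = g i m) -> f = g.
Proof.
case: f g => [f hf] [g hg] /= e.
have {}e : f = g.
  by do 2![apply: functional_extensionality_dep => ?]; apply: e.
rewrite -{}e in hg *; congr RepHom; exact: Prop_irrelevance.
Qed.

Definition rh0 : rephom V W.
Proof. by exists (fun _ _ => 0) => a m; rewrite comp_lfun0l comp_lfun0r. Defined.
Definition rhN f : rephom V W.
Proof.
exists (fun i m => - f i m) => a m.
by rewrite comp_lfunNl comp_lfunNr rh_comm.
Defined.
Definition rhD f g : rephom V W.
Proof.
exists (fun i m => f i m + g i m) => a m.
by rewrite comp_lfunDl comp_lfunDr !rh_comm.
Defined.
Fact rhDA : associative rhD.
Proof. by move=> f g h; apply: rephomP => i m; apply: addrA. Qed.
Fact rhDC : commutative rhD.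
Proof. by move=> f g; apply: rephomP => i m; apply: addrC. Qed.
Fact rh0D : left_id rh0 rhD.
Proof. by move=> f; apply: rephomP => i m; apply: add0r. Qed.
Fact rhND : left_inverse rh0 rhN rhD.
Proof. by move=> f; apply: rephomP => i m; apply: addNr. Qed.
HB.instance Definition _ := GRing.isZmodule.Build (rephom V W) rhDA rhDC rh0D rhND.
End RepHomGroup.

Definition rh_id (V : grep) : rephom V V.
Proof. by exists (fun _ _ => \1%VF) => a m; rewrite comp_lfun1l comp_lfun1r. Defined.

Definition rh_comp (U V W : grep) (g : rephom V W) (f : rephom U V) : rephom U W.
Proof.
exists (fun i m => g i m \o f i m)%VF => a m.
by rewrite -comp_lfunA rh_comm !comp_lfunA rh_comm.
Defined.

Definition Rep : precat.
Proof.
refine (@PreCat grep rephom rh_id rh_comp _ _ _ _ _).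
- by move=> X Y f; apply: rephomP => i m; apply: comp_lfun1l.
- by move=> X Y f; apply: rephomP => i m; apply: comp_lfun1r.
- by move=> W X Y Z h g f; apply: rephomP => i m; apply: comp_lfunA.
- by move=> X Y Z g g' f; apply: rephomP => i m; apply: comp_lfunDl.
- by move=> X Y Z g f f'; apply: rephomP => i m; apply: comp_lfunDr.
Defined.
End Representations.

Section ZigzagModules.
Variables (K : fieldType) (G : ade_quiver).
Local Notation A := (zigzag K G).
Local Notation zgr := (@zgr K G).

Lemma zgr_scalar (k : K) : zgr 0 (k%:A : A).
Proof.
have h1 : homog 0 (1 : pathalg K G).
  by apply: homog_sum => i _; rewrite -(pdeg_triv i); apply: homog_base.
by exists (k *: 1); split; [apply: homogZ|rewrite zpi_scale].
Qed.

Lemma zgrB d (u v : A) : zgr d u -> zgr d v -> zgr d (u - v).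
Proof. by move=> hu hv; apply: zgrD => //; apply: zgrN. Qed.

Lemma zidem_in_lideal (i : G) (v : A) : in_lideal (zidem K i) (v * zidem K i : A^o).
Proof. by apply/asboolP; exists v. Qed.

(* P_i = A e_i *)
Definition Pmod (i : G) : gmod zgr.
Proof.
refine (@GMod K A zgr (lideal (zidem K i)) (fun d x => zgr d (lval x : A)) _ _ _ _ _).
- by move=> d; rewrite linear0; apply: zgr0.
- by move=> d x y hx hy; rewrite linearB; apply: zgrB.
- by move=> d e a x ha hx; rewrite linearZ; apply: zgrM.
- move=> x; have [s [hs xs]] := zgr_span (lval x : A).
  exists [seq LIdeal (zidem_in_lideal i v) | v <- s]; split.
    move=> y /mapP[v /hs[d hd] ->]; exists d => /=.
    by rewrite -[d]addr0; apply: zgrM => //; apply: zidem_gr.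
  apply: lval_inj; rewrite big_map linear_sum /= -(lidealE (zidemM K i) x).
  by rewrite [X in X * _]xs mulr_suml.
- move=> s c us hc sc d ds; apply: lval_inj; rewrite linear0.
  apply: (@zgr_direct K G s (fun e => lval (c e)) us) => //.
  by have := congr1 (@lval _ _ _) sc; rewrite linear_sum linear0.
Defined.

(* x_ij : P_i<-m> -> P_j<-(m+1)>, right multiplication by the arrow i -> j *)
Definition xmap (a : arrows G) (m : int) :
  gmhom (gm_shift (- m, 0) (Pmod (asrc a)))
        (gm_shift (- (m + 1), 0) (Pmod (atgt a))).
Proof.
exists (@lideal_rmul K A (zidem K (asrc a)) (zidem K (atgt a))
          (zarrow K (aarrow a)) (zarrow_idem K (aarrow a))).
  exact: lideal_rmul_linear.
move=> d x /= h.
have -> : d - (- (m + 1), 0) = d - (- m, 0) + (1, 0).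
  by case: d {h} => d1 d2; congr pair; rewrite /= ?subr0 ?addr0 ?opprK ?addrA.
by apply: zgrM => //; apply: zarrow_gr.
Defined.

(* The minimal complex of X has terms which are direct sums of modules
   P_i{0}<-k> in cohomological degree k. *)
Definition in_K00 (X : Ho zgr) : Prop :=
  exists M : cplx zgr,
    [/\ isomorphic (M : Ho zgr) X, minimal M
      & forall k : int, exists (J : finType) (v : J -> G),
          gm_iso (M k) (gm_sum (fun j => gm_shift (- k, 0) (Pmod (v j))))].

Definition K00 : precat := full_subcat in_K00.

Section FunctorObject.
Variable V : grep K G.

Definition Fsummand (n : int) (i : G) : gmod zgr :=
  gm_tens (gm_shift (- n, 0) (Pmod i)) (V i n).

(* Degree n contains the P_i<-m>[-m] (x) V_i(m) with m = n, as Y[k]^n = Y^(k+n). *)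
Definition Fterm (n : int) : gmod zgr := gm_sum (Fsummand n).

Definition Fdiff_arrow (n : int) (a : arrows G) : gmhom (Fterm n) (Fterm (n + 1)) :=
  gh_comp (gh_inj (Fsummand (n + 1)) (atgt a))
    (gh_comp (gh_tens zgr_scalar (xmap a n) (rmap V a n) :
                gmhom (Fsummand n (asrc a)) (Fsummand (n + 1) (atgt a)))
      (gh_proj (Fsummand n) (asrc a))).

Definition Fdiff (n : int) : gmhom (Fterm n) (Fterm (n + 1)) :=
  \sum_a Fdiff_arrow n a.

Lemma Fterm_fg n : fin_gen (Fterm n).
Proof. by apply: dprod_fg => i; apply: dprod_fg => k; apply: lideal_fg. Qed.

Lemma Fterm_proj n : projective (Fterm n).
Proof.
apply: dprod_projective => i; apply: dprod_projective => k.
exact/lideal_projective/zidemM.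
Qed.

Lemma Fterm_bounded : exists N : nat, forall n : int, (N < `|n|)%N ->
  forall x : Fterm n, x = 0.
Proof.
have [N hN] := rfin V; exists N => n /hN h x.
apply: dprodP => i; apply: dprodP => -[k hk]; exfalso.
by move: hk; rewrite h.
Qed.

Lemma xmapM (a b : arrows G) (m : int) (x : gm_shift (- m, 0) (Pmod (asrc a))) :
  atgt a = asrc b -> (lval (xmap a m x) : A) * zarrow K (aarrow b) = 0.
Proof.
case: a x => -[i j] ha x; case: b => -[j' k] hb; rewrite /atgt /asrc /= => e.
by subst j'; rewrite -mulrA zarrowM mulr0.
Qed.

Lemma Fdiff_arrow2 (n : int) (a b : arrows G) x :
  Fdiff_arrow (n + 1) b (Fdiff_arrow n a x) = 0.
Proof.
pose y : Fsummand (n + 1) (atgt a) :=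
  gh_tens zgr_scalar (xmap a n) (rmap V a n) (x (asrc a)).
pose w : Fsummand (n + 1) (asrc b) :=
  gh_proj (Fsummand (n + 1)) (asrc b) (gh_inj (Fsummand (n + 1)) (atgt a) y).
rewrite -[LHS]/(gh_inj (Fsummand (n + 1 + 1)) (atgt b)
  (gh_tens zgr_scalar (xmap b (n + 1)) (rmap V b (n + 1)) w)).
suff -> : gh_tens zgr_scalar (xmap b (n + 1)) (rmap V b (n + 1)) w = 0.
  by rewrite linear0.
apply: dprodP => l; rewrite gh_tensE big1 // => k _.
suff -> : xmap b (n + 1) (w k) = 0 by rewrite scaler0.
have [e|ne] := eqVneq (atgt a) (asrc b); last first.
  have -> : w k = 0 by rewrite /w /= /dproj dinj_out.
  by rewrite linear0.
have [c hc] : exists c : 'I_(\dim {: V (asrc a) n}) -> A,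
    lval (w k) = \sum_l c l * (lval (xmap a n (x (asrc a) l)) : A) :> A.
  rewrite {}/w; case: (asrc b) / e k => k.
  exists (fun l => (lfun_coef (rmap V a n) k l)%:A).
  rewrite /= /dproj dinjE linear_sum; apply: eq_bigr => i _.
  by rewrite linearZ.
apply: lval_inj; rewrite linear0.
rewrite -[LHS]/((lval (w k) : A) * zarrow K (aarrow b)) hc mulr_suml big1 // => i _.
by rewrite -mulrA xmapM ?mulr0.
Qed.

Lemma Fdiff2 (n : int) x : Fdiff (n + 1) (Fdiff n x) = 0.
Proof.
rewrite /Fdiff !gh_sumE big1 // => b _; rewrite linear_sum big1 // => a _.
exact: Fdiff_arrow2.
Qed.

Definition Fcplx : cplx zgr := Cplx Fdiff2 Fterm_fg Fterm_proj Fterm_bounded.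
End FunctorObject.

Section FunctorMorphism.
Variables (V W : grep K G) (g : rephom V W).

Definition Fmor_term (n : int) : gmhom (Fterm V n) (Fterm W n) :=
  gh_sum (fun i => gh_tens zgr_scalar (gh_id _) (g i n) :
                     gmhom (Fsummand V n i) (Fsummand W n i)).

Lemma Fmor_comm (n : int) x :
  Fmor_term (n + 1) (Fdiff V n x) = Fdiff W n (Fmor_term n x).
Proof.
rewrite /Fdiff !gh_sumE linear_sum; apply: eq_bigr => a _.
set u : Fsummand V n (asrc a) := x (asrc a).
rewrite -[LHS]/(Fmor_term (n + 1) (gh_inj (Fsummand V (n + 1)) (atgt a)
  (gh_tens zgr_scalar (xmap a n) (rmap V a n) u))).
rewrite -[RHS]/(gh_inj (Fsummand W (n + 1)) (atgt a)
  (gh_tens zgr_scalar (xmap a n) (rmap W a n)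
    (gh_tens zgr_scalar (gh_id _) (g (asrc a) n) u))).
apply: etrans (gh_sum_inj _ _) _; congr (gh_inj _ _ _).
apply: etrans (esym (gh_tens_compE _ _ _ _ _ _)) _.
apply: etrans _ (gh_tens_compE _ _ _ _ _ _).
by rewrite rh_comm gh_comp1l gh_comp1r.
Qed.

Definition Fmor : chmap (Fcplx V) (Fcplx W) := @ChMap _ _ _ (Fcplx V) (Fcplx W) _ Fmor_comm.
End FunctorMorphism.

Definition Ffun : functor (Rep K G) (Ho zgr).
Proof.
exists (fun V => Fcplx V : Ho zgr) (fun V W g => htpi (Fmor g)).
- move=> V; congr htpi; apply: chmapP => n x; apply: dprodP => i.
  exact: gh_tens_idE.
- move=> U V W g f /=; rewrite ht_compE; congr htpi.
  apply: chmapP => n x; apply: dprodP => i.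
  apply: etrans _ (gh_tens_compE _ _ _ _ _ _).
  by rewrite gh_comp1l.
Defined.
End ZigzagModules.

(* Main.v *)
(* Bidegree-0 maps P_i<-n> -> P_j<-m> are the elements of bidegree (m - n, 0) in
   e_i A e_j. The relations of the zigzag algebra only involve paths of length at
   least two, so these elements are the multiples of e_i (for i = j) when m = n,
   the multiples of the arrow i -> j of the oriented quiver when m = n + 1, and 0
   when m = n - 1. Hence, between complexes of the shape of F(V), chain maps are
   morphisms of representations, every differential is F of a representation, and
   homotopies vanish. The last point makes F(V) minimal and F fully faithful; the
   first two make F essentially surjective onto K^0_0. Representations form an
   abelian category pointwise, and this transfers along the equivalence. *)
Require Import Defs.
From HB Require Import structures.
From mathcomp Require Import all_boot all_order all_algebra.
From mathcomp Require Import reals complex.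
From mathcomp Require Import generic_quotient finmap boolp monalg.
Import Defs.

Set Implicit Arguments.
Unset Strict Implicit.
Unset Printing Implicit Defensive.

Import GRing.Theory.
Local Open Scope ring_scope.

(** * Transfer of abelianness along an equivalence *)

Section PrecatBasics.
Variable C : precat.
Implicit Types X Y Z : C.

Lemma comp0c X Y Z (f : hom X Y) : (0 : hom Y Z) \oc f = 0.
Proof. by apply: (addrI (0 \oc f)); rewrite -compcDl !addr0. Qed.

Lemma compc0 X Y Z (g : hom Y Z) : g \oc (0 : hom X Y) = 0.
Proof. by apply: (addrI (g \oc 0)); rewrite -compcDr !addr0. Qed.

Lemma isomorphic_trans X Y Z :
  isomorphic X Y -> isomorphic Y Z -> isomorphic X Z.
Proof.
case=> f [g [gf fg]] [f' [g' [gf' fg']]]; exists (f' \oc f), (g \oc g').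
split.
  by rewrite -compcA (compcA g') gf' comp1c gf.
by rewrite -compcA (compcA f) fg comp1c fg'.
Qed.

Lemma is_zero_idc Z : idc Z = 0 -> is_zero Z.
Proof.
by move=> z X; split=> f; [rewrite -(comp1c f) z comp0c|rewrite -(compc1 f) z compc0].
Qed.
End PrecatBasics.

(** Cokernels in C are kernels in [opcat C], and epic maps are monic there, so the dual half of the
    abelian axioms can be transferred by the same lemmas. *)
Definition opcat (C : precat) : precat.
Proof.
refine (@PreCat C (fun X Y => @hom C Y X) (fun X => idc X)
  (fun X Y Z g f => f \oc g) _ _ _ _ _).
- by move=> X Y f; apply: compc1.
- by move=> X Y f; apply: comp1c.
- by move=> W X Y Z h g f; rewrite compcA.
- by move=> X Y Z g g' f; apply: compcDr.
- by move=> X Y Z g f f'; apply: compcDl.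
Defined.

Definition opfunctor (C D : precat) (F : functor C D) :
  functor (opcat C) (opcat D).
Proof.
exists (fun X : opcat C => F X : opcat D)
  (fun (X Y : opcat C) (f : @hom C Y X) => fhom F f).
- by move=> X; apply: fhom_id.
- by move=> X Y Z g f; apply: fhom_comp.
Defined.

Definition fully_faithful (C D : precat) (F : functor C D) : Prop :=
  forall X Y (f : hom (F X) (F Y)), exists! g : hom X Y, fhom F g = f.

Definition essentially_surjective (C D : precat) (F : functor C D) : Prop :=
  forall Y : D, exists X, isomorphic (F X) Y.

(** * Kernels and monic maps under a fully faithful, essentially surjective functor *)

Section KernelTransfer.
Variables (C D : precat) (F : functor C D).
Hypotheses (ffF : fully_faithful F) (esF : essentially_surjective F).
Hypothesis addF : additive_functor F.

Lemma fhom0 X Y : fhom F (0 : hom X Y) = 0.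
Proof. by apply: (addrI (fhom F 0)); rewrite -addF !addr0. Qed.

Lemma ff_inj X Y (f g : hom X Y) : fhom F f = fhom F g -> f = g.
Proof.
by move=> e; have [h [_ u]] := ffF (fhom F g); rewrite -(u f e) -(u g erefl).
Qed.

Lemma ff_surj X Y (f : hom (F X) (F Y)) : exists g, fhom F g = f.
Proof. by have [g [eg _]] := ffF f; exists g. Qed.

(** A test object of D is isomorphic to some [F W], so a test map can be lifted to C, factored
    through k there, and mapped back. *)
Lemma ff_kernel X Y N (f : hom X Y) (k : hom N X) :
  is_kernel f k -> is_kernel (fhom F f) (fhom F k).
Proof.
case=> fk uk; split; first by rewrite -fhom_comp fk fhom0.
move=> W' h fh; have [W [phi [psi [psi1 phi1]]]] := esF W'.
have [h1 eh1] := ff_surj (h \oc phi).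
have fh1 : f \oc h1 = 0.
  by apply: ff_inj; rewrite fhom_comp eh1 fhom0 compcA fh comp0c.
have [u [eu uu]] := uk _ _ fh1.
exists (fhom F u \oc psi); split.
  by rewrite compcA -fhom_comp eu eh1 -compcA phi1 compc1.
move=> v ev; have [v1 ev1] := ff_surj (v \oc phi).
have -> : u = v1.
  by apply: uu; apply: ff_inj; rewrite fhom_comp ev1 compcA ev eh1.
by rewrite ev1 -compcA phi1 compc1.
Qed.

(** Following f by the split monomorphism b does not change what f kills, and the isomorphism a
    carries the kernel over to X'. *)
Lemma kernel_iso (E : precat) (X Y X' Y' N : E) (f : hom X Y) (k : hom N X)
    (a : hom X X') (a' : hom X' X) (b : hom Y Y') (b' : hom Y' Y) :
  a' \oc a = idc X -> a \oc a' = idc X' -> b' \oc b = idc Y ->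
  is_kernel f k -> is_kernel (b \oc f \oc a') (a \oc k).
Proof.
move=> a'a aa' b'b [fk uk]; split.
  by rewrite -compcA (compcA a') a'a comp1c -compcA fk compc0.
move=> W h eh; have fa'h : f \oc (a' \oc h) = 0.
  by rewrite -[LHS]comp1c -b'b -compcA (compcA f) (compcA b) (compcA b) eh compc0.
have [u [eu uu]] := uk _ _ fa'h; exists u; split.
  by rewrite -compcA eu compcA aa' comp1c.
by move=> v ev; apply: uu; rewrite -ev !compcA a'a comp1c.
Qed.

Lemma transfer_kernel : abelian C ->
  forall (X Y : D) (f : hom X Y), exists N (k : hom N X), is_kernel f k.
Proof.
move=> abC X' Y' f'.
have [X [a [a' [a'a aa']]]] := esF X'; have [Y [b [b' [b'b bb']]]] := esF Y'.
have [f ef] := ff_surj (b' \oc f' \oc a).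
have [N [k kerk]] := ab_kernel abC f; exists (F N), (a \oc fhom F k).
have -> : f' = b \oc fhom F f \oc a'.
  by rewrite ef !compcA bb' comp1c -compcA aa' compc1.
exact: kernel_iso a'a aa' b'b (ff_kernel kerk).
Qed.

(** The map f' is conjugate to some [fhom F f], and f is monic because F is faithful. So f is the
    kernel of some g, and f' is the kernel of [fhom F g \oc b']. *)
Lemma transfer_monic : abelian C ->
  forall (X Y : D) (f : hom X Y), monic f ->
    exists Z (g : hom Y Z), is_kernel g f.
Proof.
move=> abC X' Y' f' mf'.
have [X [a [a' [a'a aa']]]] := esF X'; have [Y [b [b' [b'b bb']]]] := esF Y'.
have [f ef] := ff_surj (b' \oc f' \oc a).
have ef' : b \oc fhom F f = f' \oc a by rewrite ef !compcA bb' comp1c.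
have mf : monic f.
  move=> W g h /(congr1 (fhom F)); rewrite !fhom_comp => /(congr1 (compc b)).
  rewrite !compcA ef' -!compcA => /mf' e; apply: ff_inj.
  by rewrite -[LHS]comp1c -a'a -compcA e compcA a'a comp1c.
have [Z [g [gf ug]]] := ab_monic abC mf; exists (F Z), (fhom F g \oc b').
have [Fgf uFg] := ff_kernel (conj gf ug).
have b'f' : b' \oc f' = fhom F f \oc a'.
  by rewrite ef -!compcA aa' compc1.
split; first by rewrite -compcA b'f' compcA Fgf comp0c.
move=> W h; rewrite -compcA => /uFg[u [eu uu]]; exists (a \oc u); split.
  by rewrite compcA -ef' -compcA eu compcA bb' comp1c.
move=> v ev; rewrite -[v]comp1c -aa' -compcA; congr (_ \oc _); apply: uu.
by rewrite compcA -b'f' -compcA ev.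
Qed.
End KernelTransfer.

(** * Transfer of all the abelian axioms, and a quasi-inverse *)

Section Transfer.
Variables (C D : precat) (F : functor C D).
Hypotheses (ffF : fully_faithful F) (esF : essentially_surjective F).
Hypothesis addF : additive_functor F.

Lemma op_fully_faithful : fully_faithful (opfunctor F).
Proof. by move=> X Y f; apply: ffF. Qed.

Lemma op_essentially_surjective : essentially_surjective (opfunctor F).
Proof.
by move=> Y; have [X [f [g [gf fg]]]] := esF Y; exists X, g, f.
Qed.

Lemma op_additive : additive_functor (opfunctor F).
Proof. by move=> X Y f g; apply: addF. Qed.

Lemma op_biproduct (E : precat) (X Y S : E) i j p q :
  @is_biproduct E X Y S i j p q -> @is_biproduct (opcat E) X Y S p q i j.
Proof. by case. Qed.

Lemma op_abelian (E : precat) : abelian E -> abelian (opcat E).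
Proof.
case=> [[Z hZ] bip ker coker mon epi]; split.
- by exists Z => X; have [] := hZ X.
- move=> X Y; have [S [i [j [p [q h]]]]] := bip X Y.
  by exists S, p, q, i, j; apply: op_biproduct.
- by move=> X Y f; apply: coker.
- by move=> X Y f; apply: ker.
- by move=> X Y f; apply: epi.
- by move=> X Y f; apply: mon.
Qed.

Lemma transfer_biproduct : abelian C ->
  forall X Y : D, exists S i j p q, @is_biproduct D X Y S i j p q.
Proof.
move=> abC X' Y'.
have [X [a [a' [a'a aa']]]] := esF X'; have [Y [b [b' [b'b bb']]]] := esF Y'.
have [S [i [j [p [q [pi qj pj qi ijS]]]]]] := ab_biproduct abC X Y.
exists (F S), (fhom F i \oc a'), (fhom F j \oc b'), (a \oc fhom F p), (b \oc fhom F q).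
split.
- by rewrite -compcA (compcA _ (fhom F i)) -fhom_comp pi fhom_id comp1c.
- by rewrite -compcA (compcA _ (fhom F j)) -fhom_comp qj fhom_id comp1c.
- by rewrite -compcA (compcA _ (fhom F j)) -fhom_comp pj fhom0 // comp0c compc0.
- by rewrite -compcA (compcA _ (fhom F i)) -fhom_comp qi fhom0 // comp0c compc0.
- rewrite -compcA (compcA a') a'a comp1c -[X in _ + X]compcA (compcA b') b'b comp1c.
  by rewrite -!fhom_comp -addF ijS fhom_id.
Qed.

Lemma transfer_abelian : abelian C -> abelian D.
Proof.
move=> abC; split.
- have [Z hZ] := ab_zero abC; exists (F Z); apply: is_zero_idc.
  by rewrite -fhom_id (proj1 (hZ Z) (idc Z)) fhom0.
- exact: transfer_biproduct.
- exact: (transfer_kernel ffF esF addF abC).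
(* A cokernel in D is a kernel in the opposite category, so the transfer of kernels is applied to
   [opfunctor F]. *)
- move=> X Y f.
  exact: (transfer_kernel op_fully_faithful op_essentially_surjective op_additive
    (op_abelian abC) (f : @hom (opcat D) Y X)).
- exact: (transfer_monic ffF esF addF abC).
- move=> X Y f ef.
  exact: (transfer_monic op_fully_faithful op_essentially_surjective op_additive
    (op_abelian abC) (ef : @monic (opcat D) Y X f)).
Qed.

Lemma ff_es_equivalence : equivalence F.
Proof.
pose ob Y := projT1 (cid (esF Y)).
pose phi Y : hom (F (ob Y)) Y := projT1 (cid (projT2 (cid (esF Y)))).
have phiP Y : is_iso (phi Y) by exact: (projT2 (cid (projT2 (cid (esF Y))))).
pose psi Y : hom Y (F (ob Y)) := projT1 (cid (phiP Y)).
have psiP Y : psi Y \oc phi Y = idc _ /\ phi Y \oc psi Y = idc _.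
  exact: (projT2 (cid (phiP Y))).
(* [lift] inverts [fhom F] on each hom group. Identities between lifts are checked after applying F,
   which is injective on maps. *)
pose lift X Y (f : hom (F X) (F Y)) : hom X Y := projT1 (cid (ff_surj ffF f)).
have liftP X Y (f : hom (F X) (F Y)) : fhom F (lift X Y f) = f.
  exact: (projT2 (cid (ff_surj ffF f))).
have lift_id Y : lift _ _ (psi Y \oc idc Y \oc phi Y) = idc (ob Y).
  by apply: (ff_inj ffF); rewrite liftP fhom_id compc1 (proj1 (psiP Y)).
have lift_comp X Y Z (g : hom Y Z) (f : hom X Y) :
    lift _ _ (psi Z \oc (g \oc f) \oc phi X) =
    lift _ _ (psi Z \oc g \oc phi Y) \oc lift _ _ (psi Y \oc f \oc phi X).
  apply: (ff_inj ffF); rewrite fhom_comp !liftP -!compcA; do 2!congr (_ \oc _).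
  by rewrite !compcA (proj2 (psiP Y)) comp1c.
pose G := @Functor D C ob (fun X Y f => lift _ _ (psi Y \oc f \oc phi X))
  lift_id lift_comp.
exists G; split.
  exists (fun X => lift (ob (F X)) X (phi (F X))); split.
    move=> X; exists (lift X (ob (F X)) (psi (F X))).
    split; apply: (ff_inj ffF); rewrite fhom_comp !liftP fhom_id;
      by case: (psiP (F X)).
  move=> X Y f; apply: (ff_inj ffF) => /=; rewrite !fhom_comp !liftP.
  by rewrite !compcA (proj2 (psiP _)) comp1c.
exists phi; split=> // X Y f /=; rewrite liftP !compcA.
by rewrite (proj2 (psiP _)) comp1c.
Qed.

Lemma ff_es_abelian_equivalence : abelian C -> abelian_equivalence F.
Proof.
by move=> abC; split=> //; [apply: transfer_abelian|apply: ff_es_equivalence].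
Qed.
End Transfer.

(** * The category of representations *)

Section LinearMaps.
Variable K : fieldType.

Lemma linfun_exists (U V : vectType K) (f : U -> V) :
  linear f -> {g : 'Hom(U, V) | forall x, g x = f x}.
Proof.
move=> lf; pose F : {linear U -> V} := HB.pack f (GRing.isLinear.Build K U V *:%R f lf).
by exists (linfun F) => x; rewrite lfunE.
Qed.

Lemma lker_space (V W : vectType K) (f : 'Hom(V, W)) :
  {N : vectType K & {k : 'Hom(N, V) | lker k = 0%VS & limg k = lker f}}.
Proof.
exists (subvs_of (lker f)); exists (linfun (@vsval _ _ (lker f))).
  by apply/eqP/lker0P => x y; rewrite !lfunE; apply: subvs_inj.
apply/vspaceP => x; apply/memv_imgP/idP => [[u _ ->]|xf].
  by rewrite lfunE; apply: subvsP.
by exists (Subvs xf); rewrite ?memvf // lfunE.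
Qed.

(** The quotient by the image U is modelled on the complement [U^C], with c the projection onto it
    along U. *)
Lemma lcoker_space (V W : vectType K) (f : 'Hom(V, W)) :
  {Q : vectType K & {c : 'Hom(W, Q) | limg c = fullv & lker c = limg f}}.
Proof.
pose U := limg f; exists (subvs_of (U^C)%VS).
have [c hc] : {c : 'Hom(W, subvs_of (U^C)%VS) |
    forall x, vsval (c x) = daddv_pi U^C U x}.
  pose p := daddv_pi U^C U.
  have pU x : p x \in (U^C)%VS by apply: memv_pi.
  have [|c hc] := @linfun_exists W (subvs_of (U^C)%VS) (fun x => Subvs (pU x)).
    by move=> a x y; apply: subvs_inj; rewrite [RHS]linearP; apply: linearP.
  by exists c => x; rewrite hc.
have dUC : (U^C :&: U)%VS = 0%VS by rewrite capvC; apply: capv_compl.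
have dUC' : (U :&: U^C)%VS = 0%VS by apply: capv_compl.
exists c.
  apply/vspaceP => x; rewrite memvf; apply/memv_imgP; exists (vsval x).
    exact: memvf.
  by apply: subvs_inj; rewrite hc daddv_pi_id // subvsP.
apply/vspaceP => x; rewrite memv_ker.
have -> : (c x == 0) = (daddv_pi U^C U x == 0).
  by rewrite -(inj_eq (@subvs_inj _ _ _)) hc linear0.
have dx : daddv_pi U^C U x + daddv_pi U U^C x = x.
  by apply: daddv_pi_add => //; rewrite addvC addv_complf memvf.
apply/eqP/idP => [e|xU].
  by rewrite -dx e add0r memv_pi.
by apply: (addIr (daddv_pi U U^C x)); rewrite dx add0r daddv_pi_id.
Qed.

(** [k^-1] is a right inverse of k on the image of k, so composing it with h gives the
    factorisation. *)
Lemma lfun_lift (U N V : vectType K) (k : 'Hom(N, V)) (h : 'Hom(U, V)) :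
  (limg h <= limg k)%VS -> {u : 'Hom(U, N) | (k \o u)%VF = h}.
Proof.
move=> hk; exists (k^-1 \o h)%VF; apply/lfunP => x; rewrite !comp_lfunE.
by rewrite limg_lfunVK // (subvP hk) // memv_img ?memvf.
Qed.

(** Since c is onto, x and [c^-1 (c x)] differ by an element of the kernel of c, on which h
    vanishes. *)
Lemma lfun_descend (V Q W : vectType K) (c : 'Hom(V, Q)) (h : 'Hom(V, W)) :
  limg c = fullv -> (lker c <= lker h)%VS -> {u : 'Hom(Q, W) | (u \o c)%VF = h}.
Proof.
move=> cs ch; exists (h \o c^-1)%VF; apply/lfunP => x; rewrite !comp_lfunE.
apply/eqP; rewrite -subr_eq0 -linearB -memv_ker (subvP ch) // memv_ker linearB.
by rewrite subr_eq0; apply/eqP/limg_lfunVK/memv_img/memvf.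
Qed.

Lemma lker0_cancel (U N V : vectType K) (k : 'Hom(N, V)) (u v : 'Hom(U, N)) :
  lker k = 0%VS -> (k \o u)%VF = (k \o v)%VF -> u = v.
Proof.
move=> /eqP/lker0P ik e; apply/lfunP => x; apply: ik.
by rewrite -!comp_lfunE e.
Qed.

Lemma limgf_cancel (V Q W : vectType K) (c : 'Hom(V, Q)) (u v : 'Hom(Q, W)) :
  limg c = fullv -> (u \o c)%VF = (v \o c)%VF -> u = v.
Proof.
move=> sc e; apply/lfunP => y; have := memvf y; rewrite -sc => /memv_imgP[x _ ->].
by rewrite -!comp_lfunE e.
Qed.

Lemma comp_lfun_eq0 (U V W : vectType K) (g : 'Hom(V, W)) (f : 'Hom(U, V)) :
  (g \o f)%VF = 0 <-> (limg f <= lker g)%VS.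
Proof.
split=> [e|s]; last first.
  apply/lfunP => x; rewrite comp_lfunE lfunE /=; apply/eqP.
  by rewrite -memv_ker (subvP s) // memv_img ?memvf.
apply/subvP => y /memv_imgP[x _ ->].
by rewrite memv_ker -comp_lfunE e lfunE.
Qed.

Lemma dim_lker0 (U V : vectType K) (f : 'Hom(U, V)) :
  lker f = 0%VS -> \dim {: V} = 0%N -> \dim {: U} = 0%N.
Proof.
move=> kf dV; have := limg_ker_dim f fullv; rewrite kf capv0 dimv0 add0n => <-.
by apply/eqP; rewrite -leqn0 -dV dimvS // subvf.
Qed.

Lemma dim_limgf (U V : vectType K) (f : 'Hom(U, V)) :
  limg f = fullv -> \dim {: U} = 0%N -> \dim {: V} = 0%N.
Proof.
move=> sf dU; have /eqP := limg_ker_dim f fullv.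
by rewrite dU addn_eq0 sf => /andP[_ /eqP].
Qed.

Lemma lker_full0 (U V : vectType K) : lker (0 : 'Hom(U, V)) = fullv.
Proof. by apply/vspaceP => x; rewrite memv_ker lfunE memvf /= eqxx. Qed.

Lemma limg0 (U V : vectType K) : limg (0 : 'Hom(U, V)) = 0%VS.
Proof.
by apply/eqP; rewrite -subv0; apply/subvP => y /memv_imgP[x _ ->]; rewrite lfunE memv0.
Qed.
End LinearMaps.

(** * The abelian axioms for representations, vertex by vertex *)

Section RepAbelian.
Variables (K : fieldType) (G : ade_quiver).
Implicit Types V W N Q : Rep K G.

(** Factor h at each vertex and degree. The factors commute with the structure maps because both
    sides agree after composing with the injective map k. *)
Lemma Rep_kernelP V W N (f : hom V W) (k : hom N V) :
  (forall i m, lker (k i m) = 0%VS) -> (forall i m, limg (k i m) = lker (f i m)) ->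
  is_kernel f k.
Proof.
move=> ik ek; split.
  by apply: rephomP => i m; apply/comp_lfun_eq0; rewrite ek.
move=> U h fh.
have hk i m : (limg (h i m) <= limg (k i m))%VS.
  rewrite ek; apply/comp_lfun_eq0.
  exact: (congr1 (fun t : rephom U W => t i m) fh).
pose u i m : 'Hom(U i m, N i m) := sval (lfun_lift (hk i m)).
have uP i m : (k i m \o u i m)%VF = h i m by exact: (svalP (lfun_lift (hk i m))).
have uc a m : (u (atgt a) (m + 1) \o rmap U a m)%VF = (rmap N a m \o u (asrc a) m)%VF.
  apply: (lker0_cancel (ik (atgt a) (m + 1))); rewrite comp_lfunA uP rh_comm.
  by rewrite comp_lfunA rh_comm -comp_lfunA uP.
exists (RepHom uc); split; first exact: rephomP.
move=> v ev; apply: rephomP => i m; apply: (lker0_cancel (ik i m)).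
by rewrite [LHS]uP -ev.
Qed.

Lemma Rep_cokernelP V W Q (f : hom V W) (c : hom W Q) :
  (forall i m, limg (c i m) = fullv) -> (forall i m, lker (c i m) = limg (f i m)) ->
  is_cokernel f c.
Proof.
move=> sc ec; split.
  by apply: rephomP => i m; apply/comp_lfun_eq0; rewrite ec.
move=> Z h hf.
have ch i m : (lker (c i m) <= lker (h i m))%VS.
  rewrite ec; apply/comp_lfun_eq0.
  exact: (congr1 (fun t : rephom V Z => t i m) hf).
pose u i m : 'Hom(Q i m, Z i m) := sval (lfun_descend (sc i m) (ch i m)).
have uP i m : (u i m \o c i m)%VF = h i m.
  exact: (svalP (lfun_descend (sc i m) (ch i m))).
have uc a m : (u (atgt a) (m + 1) \o rmap Q a m)%VF = (rmap Z a m \o u (asrc a) m)%VF.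
  apply: (limgf_cancel (sc (asrc a) m)); rewrite -comp_lfunA -rh_comm.
  by rewrite comp_lfunA uP rh_comm -comp_lfunA uP.
exists (RepHom uc); split; first exact: rephomP.
move=> v ev; apply: rephomP => i m; apply: (limgf_cancel (sc i m)).
by rewrite [LHS]uP -ev.
Qed.

(** The structure maps of V send the kernel at the source of an arrow into the kernel at its target,
    so they restrict. The pointwise description of k is kept for [Rep_monic] and [Rep_abelian]. *)
Lemma Rep_kernel V W (f : hom V W) : exists N (k : hom N V),
  [/\ is_kernel f k, forall i m, lker (k i m) = 0%VS
    & forall i m, limg (k i m) = lker (f i m)].
Proof.
pose N i m := projT1 (lker_space (f i m)).
pose k i m : 'Hom(N i m, V i m) := s2val (projT2 (lker_space (f i m))).
have ik i m : lker (k i m) = 0%VS by exact: (s2valP (projT2 (lker_space (f i m)))).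
have ek i m : limg (k i m) = lker (f i m).
  exact: (s2valP' (projT2 (lker_space (f i m)))).
have sub (a : arrows G) m :
    (limg (rmap V a m \o k (asrc a) m)%VF <= limg (k (atgt a) (m + 1)%R))%VS.
  rewrite ek; apply/comp_lfun_eq0.
  rewrite comp_lfunA rh_comm -comp_lfunA.
  have -> : (f (asrc a) m \o k (asrc a) m)%VF = 0 by apply/comp_lfun_eq0; rewrite ek.
  by rewrite comp_lfun0r.
pose r a m := sval (lfun_lift (sub a m)).
have rP a m : (k (atgt a) (m + 1) \o r a m)%VF = (rmap V a m \o k (asrc a) m)%VF.
  exact: (svalP (lfun_lift (sub a m))).
have fin : exists n : nat, forall i (m : int), (n < `|m|)%N -> \dim {: N i m} = 0%N.
  by have [n hn] := rfin V; exists n => i m /(hn i); apply: dim_lker0 (ik i m).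
exists (@GRep K G N r fin : Rep K G), (@RepHom K G (GRep r fin) V k rP).
by split=> //; apply: Rep_kernelP.
Qed.

Lemma Rep_cokernel V W (f : hom V W) : exists Q (c : hom W Q),
  [/\ is_cokernel f c, forall i m, limg (c i m) = fullv
    & forall i m, lker (c i m) = limg (f i m)].
Proof.
pose Q i m := projT1 (lcoker_space (f i m)).
pose c i m : 'Hom(W i m, Q i m) := s2val (projT2 (lcoker_space (f i m))).
have sc i m : limg (c i m) = fullv by exact: (s2valP (projT2 (lcoker_space (f i m)))).
have ec i m : lker (c i m) = limg (f i m).
  exact: (s2valP' (projT2 (lcoker_space (f i m)))).
have sub (a : arrows G) m :
    (lker (c (asrc a) m) <= lker (c (atgt a) (m + 1)%R \o rmap W a m)%VF)%VS.
  rewrite ec; apply/comp_lfun_eq0; rewrite -comp_lfunA -rh_comm comp_lfunA.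
  have -> : (c (atgt a) (m + 1) \o f (atgt a) (m + 1))%VF = 0.
    by apply/comp_lfun_eq0; rewrite ec.
  by rewrite comp_lfun0l.
pose r a m := sval (lfun_descend (sc (asrc a) m) (sub a m)).
have rP a m : (c (atgt a) (m + 1) \o rmap W a m)%VF = (r a m \o c (asrc a) m)%VF.
  by rewrite (svalP (lfun_descend (sc (asrc a) m) (sub a m))).
have fin : exists n : nat, forall i (m : int), (n < `|m|)%N -> \dim {: Q i m} = 0%N.
  by have [n hn] := rfin W; exists n => i m /(hn i); apply: dim_limgf (sc i m).
exists (@GRep K G Q r fin : Rep K G), (@RepHom K G W (GRep r fin) c rP).
by split=> //; apply: Rep_cokernelP.
Qed.

(** The kernel inclusion k satisfies f k = 0 = f 0, so k = 0, while its image at each vertex is the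
    kernel of f. *)
Lemma Rep_monic V W (f : hom V W) : monic f -> forall i m, lker (f i m) = 0%VS.
Proof.
move=> mf i m; have [N [k [[fk _] _ <-]]] := Rep_kernel f.
have -> : k = 0 by apply: mf; rewrite fk compc0.
exact: limg0.
Qed.

Lemma Rep_epic V W (f : hom V W) : epic f -> forall i m, limg (f i m) = fullv.
Proof.
move=> ef i m; have [Q [c [[cf _] _ <-]]] := Rep_cokernel f.
have -> : c = 0 by apply: ef; rewrite cf comp0c.
exact: lker_full0.
Qed.

Lemma Rep_zero : exists Z : Rep K G, is_zero Z.
Proof.
pose Z (_ : G) (_ : int) : vectType K := 'rV[K]_0.
have fin : exists n : nat, forall (i : G) (m : int), (n < `|m|)%N -> \dim {: Z i m} = 0%N.
  by exists 0%N => i m _; rewrite dimvf /dim /= muln0.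
exists (@GRep K G Z (fun _ _ => 0) fin : Rep K G); apply: is_zero_idc.
by apply: rephomP => i m; apply/lfunP => x; apply/rowP => -[].
Qed.

Lemma Rep_biproduct V W : exists S i j p q, @is_biproduct (Rep K G) V W S i j p q.
Proof.
pose S (l : G) (m : int) : vectType K := (V l m * W l m)%type.
have r a m : {r : 'Hom(S (asrc a) m, S (atgt a) (m + 1)) |
    forall x, r x = (rmap V a m x.1, rmap W a m x.2)}.
  by apply: linfun_exists => c x y; rewrite /= !linearP.
have i l m : {i : 'Hom(V l m, S l m) | forall x, i x = (x, 0)}.
  by apply: linfun_exists => c x y; apply: injective_projections; rewrite /= ?scaler0 ?addr0.
have j l m : {j : 'Hom(W l m, S l m) | forall x, j x = (0, x)}.
  by apply: linfun_exists => c x y; apply: injective_projections; rewrite /= ?scaler0 ?addr0.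
have p l m : {p : 'Hom(S l m, V l m) | forall x, p x = x.1} by apply: linfun_exists.
have q l m : {q : 'Hom(S l m, W l m) | forall x, q x = x.2} by apply: linfun_exists.
have fin : exists n : nat, forall l (m : int), (n < `|m|)%N -> \dim {: S l m} = 0%N.
  have [n1 h1] := rfin V; have [n2 h2] := rfin W; exists (maxn n1 n2) => l m.
  rewrite gtn_max => /andP[/(h1 l) + /(h2 l)]; rewrite !dimvf => e1 e2.
  by rewrite /dim /= -[X in (X + _)%N]/(dim (V l m)) e1 -[X in (_ + X)%N]/(dim (W l m)) e2.
pose B : Rep K G := @GRep K G S (fun a m => sval (r a m)) fin.
have ic a (m : int) : (sval (i (atgt a) (m + 1)) \o rmap V a m)%VF =
    (rmap B a m \o sval (i (asrc a) m))%VF.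
  by apply/lfunP => x; rewrite !comp_lfunE (svalP (r a m)) !(svalP (i _ _)) /= linear0.
have jc a (m : int) : (sval (j (atgt a) (m + 1)) \o rmap W a m)%VF =
    (rmap B a m \o sval (j (asrc a) m))%VF.
  by apply/lfunP => x; rewrite !comp_lfunE (svalP (r a m)) !(svalP (j _ _)) /= linear0.
have pc a (m : int) : (sval (p (atgt a) (m + 1)) \o rmap B a m)%VF =
    (rmap V a m \o sval (p (asrc a) m))%VF.
  by apply/lfunP => x; rewrite !comp_lfunE (svalP (r a m)) !(svalP (p _ _)).
have qc a (m : int) : (sval (q (atgt a) (m + 1)) \o rmap B a m)%VF =
    (rmap W a m \o sval (q (asrc a) m))%VF.
  by apply/lfunP => x; rewrite !comp_lfunE (svalP (r a m)) !(svalP (q _ _)).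
exists B, (@RepHom K G V B (fun l m => sval (i l m)) ic),
  (@RepHom K G W B (fun l m => sval (j l m)) jc),
  (@RepHom K G B V (fun l m => sval (p l m)) pc),
  (@RepHom K G B W (fun l m => sval (q l m)) qc).
split; apply: rephomP => l m; apply/lfunP => x.
- by rewrite /= comp_lfunE id_lfunE (svalP (i l m)) (svalP (p l m)).
- by rewrite /= comp_lfunE id_lfunE (svalP (j l m)) (svalP (q l m)).
- by rewrite /= comp_lfunE lfunE (svalP (j l m)) (svalP (p l m)).
- by rewrite /= comp_lfunE lfunE (svalP (i l m)) (svalP (q l m)).
- rewrite /= add_lfunE !comp_lfunE id_lfunE (svalP (i l m)) (svalP (p l m)).
  rewrite (svalP (j l m)) (svalP (q l m)); case: x => x y /=.
  by congr pair; rewrite ?addr0 ?add0r.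
Qed.

Lemma Rep_abelian : abelian (Rep K G).
Proof.
split.
- exact: Rep_zero.
- exact: Rep_biproduct.
- by move=> V W f; have [N [k [kerk _ _]]] := Rep_kernel f; exists N, k.
- by move=> V W f; have [Q [c [cokc _ _]]] := Rep_cokernel f; exists Q, c.
(* A monic f is the kernel of its cokernel c: it is injective at each vertex, and its image is the
   kernel of c. The epic case is dual. *)
- move=> V W f /Rep_monic mf; have [Q [c [_ _ ec]]] := Rep_cokernel f.
  by exists Q, c; apply: Rep_kernelP => // i m; rewrite ec.
- move=> V W f /Rep_epic ef; have [N [k [_ _ ek]]] := Rep_kernel f.
  by exists N, k; apply: Rep_cokernelP => // i m; rewrite ek.
Qed.
End RepAbelian.

(** * The zigzag algebra in low degrees *)

Section ZigzagCoefficients.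
Variables (K : fieldType) (G : ade_quiver).
Local Notation A := (zigzag K G).
Local Notation zgr := (@zgr K G).
Implicit Types (x y : pathalg K G) (p q : qpath G) (u v : A).

Lemma mcoeff_pathalgZ (c : K) x p : (c *: x : pathalg K G)@_p = c * x@_p.
Proof. exact: mcoeffZ. Qed.

Lemma mcoeff_pathalg_sum (T : Type) (s : seq T) (P : pred T) (F : T -> pathalg K G) p :
  (\sum_(t <- s | P t) F t)@_p = \sum_(t <- s | P t) (F t)@_p.
Proof. exact: raddf_sum. Qed.

Lemma mcoeff_pbaseM p q (t : qpath G) :
  (pbase K p * pbase K q)@_t = (pcat p q == Some t)%:R.
Proof.
by rewrite pbaseM /pbase_mul; case: (pcat p q) => [r|]; rewrite ?mcoeff_pbase ?mcoeff0.
Qed.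

Lemma mcoeff_pathalgM x y (t : qpath G) :
  (x * y)@_t = \sum_(p <- msupp x) \sum_(q <- msupp y)
    x@_p * y@_q * (pcat p q == Some t)%:R.
Proof.
rewrite {1}(pathalgE x) {1}(pathalgE y) mulr_suml mcoeff_pathalg_sum.
apply: eq_bigr => p _; rewrite mulr_sumr mcoeff_pathalg_sum; apply: eq_bigr => q _.
by rewrite -scalerAl -scalerAr scalerA mcoeff_pathalgZ mcoeff_pbaseM.
Qed.

Lemma mcoeff_trivl i x p : (pbase K (ptriv i) * x)@_p = (i == psrc p)%:R * x@_p.
Proof.
rewrite (pathalgE x) mulr_sumr !mcoeff_pathalg_sum mulr_sumr; apply: eq_bigr => q _.
rewrite -scalerAr; apply: etrans (mcoeff_pathalgZ _ _ _) _.
apply: etrans _ (congr1 ( *%R _) (esym (mcoeff_pathalgZ _ _ _))).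
rewrite mcoeff_pbaseM pcat_trivl mcoeff_pbase mulrCA; congr (_ * _).
have [<-|ne] := eqVneq q p; first by case: (i == _); rewrite ?eqxx ?mulr1.
by rewrite mulr0; case: ifP => // _; case: eqP => // -[e]; rewrite e eqxx in ne.
Qed.

Lemma mcoeff_trivr i x p : (x * pbase K (ptriv i))@_p = (i == ptgt p)%:R * x@_p.
Proof.
rewrite (pathalgE x) mulr_suml !mcoeff_pathalg_sum mulr_sumr; apply: eq_bigr => q _.
rewrite -scalerAl; apply: etrans (mcoeff_pathalgZ _ _ _) _.
apply: etrans _ (congr1 ( *%R _) (esym (mcoeff_pathalgZ _ _ _))).
rewrite mcoeff_pbaseM pcat_trivr mcoeff_pbase mulrCA; congr (_ * _).
have [<-|ne] := eqVneq q p; first by case: (i == _); rewrite ?eqxx ?mulr1.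
by rewrite mulr0; case: ifP => // _; case: eqP => // -[e]; rewrite e eqxx in ne.
Qed.

Lemma psize_cat p q t : pcat p q = Some t -> psize t = (psize p + psize q)%N.
Proof. by case/pcat_some => _ vt; rewrite /psize {1}/psteps vt size_cat. Qed.

(** The relations involve only paths of length at least two, and multiplication never shortens a
    path. So coefficients at paths of length at most one descend to the quotient. *)
Lemma zigzag_ideal_short x p : zigzag_ideal x -> (psize p <= 1)%N -> x@_p = 0.
Proof.
pose long y := forall q, (psize q <= 1)%N -> y@_q = 0.
have longM y z : long y \/ long z -> long (y * z).
  move=> h t st; rewrite mcoeff_pathalgM big1 // => q _; rewrite big1 // => r _.
  case: eqP => [/psize_cat e|_]; last by rewrite mulr0.
  have [sq sr] : (psize q <= 1)%N /\ (psize r <= 1)%N.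
    by split; apply: leq_trans st; rewrite e ?leq_addr ?leq_addl.
  by case: h => h; rewrite h ?mulr0 ?mul0r.
suff: zigzag_ideal x -> long x by move=> h /h; apply.
case=> s [hs ->]; rewrite big_seq.
apply: (big_ind long) => [q _|y z hy hz q sq|t /hs ht].
- exact: mcoeff0.
- by rewrite mcoeffD hy ?hz ?addr0.
- apply: (longM); left; apply: (longM); right => q sq; apply/eqP/negPn/negP.
  by move/(zigzag_rel_size ht); rewrite ltnNge sq.
Qed.

(** Taken on a chosen representative; by [zcoef_pi] the choice is immaterial when p has length at
    most one. *)
Definition zcoef p u : K := (repr u)@_p.

Lemma zcoef_pi p x : (psize p <= 1)%N -> zcoef p (zpi x) = x@_p.
Proof.
move=> sp; apply/eqP; rewrite -subr_eq0 /zcoef -mcoeffB; apply/eqP.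
exact: zigzag_ideal_short (zpi_repr x) sp.
Qed.

Lemma zcoefD p u v : (psize p <= 1)%N -> zcoef p (u + v) = zcoef p u + zcoef p v.
Proof.
by move=> sp; rewrite -(zpiK u) -(zpiK v) -raddfD !zcoef_pi // mcoeffD.
Qed.

Lemma zcoef0 p : (psize p <= 1)%N -> zcoef p 0 = 0.
Proof. by move=> sp; rewrite -(raddf0 (@zpi K G)) zcoef_pi // mcoeff0. Qed.

Lemma zcoefZ p (c : K) u : (psize p <= 1)%N -> zcoef p (c *: u) = c * zcoef p u.
Proof.
move=> sp; rewrite -(zpiK u) -zpi_scale !zcoef_pi //; exact: mcoeff_pathalgZ.
Qed.

Lemma zcoef_sum (T : Type) (s : seq T) (P : pred T) (F : T -> A) p :
  (psize p <= 1)%N ->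
  zcoef p (\sum_(t <- s | P t) F t) = \sum_(t <- s | P t) zcoef p (F t).
Proof.
move=> sp; apply: (big_morph (zcoef p)) => [u v|]; first exact: zcoefD.
exact: zcoef0.
Qed.

Lemma zcoef_trivl i u p : (psize p <= 1)%N ->
  zcoef p (zidem K i * u) = (i == psrc p)%:R * zcoef p u.
Proof.
by move=> sp; rewrite -(zpiK u) -zpi_mul !zcoef_pi // mcoeff_trivl.
Qed.

Lemma zcoef_trivr i u p : (psize p <= 1)%N ->
  zcoef p (u * zidem K i) = (i == ptgt p)%:R * zcoef p u.
Proof.
by move=> sp; rewrite -(zpiK u) -zpi_mul !zcoef_pi // mcoeff_trivr.
Qed.

Definition zcoef_triv (i : G) : A -> K := zcoef (ptriv i).
Definition zcoef_arrow (a : arrows G) : A -> K := zcoef (parrow (aarrow a)).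

(** A homogeneous u lifts to a combination of paths of bidegree d. These all occur among the [b t],
    which are short, so their coefficients can be read off u itself. *)
Lemma zgr_basis (T : finType) (b : T -> qpath G) d u : injective b ->
  (forall p, pdeg p = d -> exists t, p = b t) ->
  zgr d u -> (forall t, (psize (b t) <= 1)%N) ->
  u = \sum_t zcoef (b t) u *: zpi (pbase K (b t)).
Proof.
move=> ib hb [x [hx ->]] sb; under eq_bigr => t _ do rewrite zcoef_pi // -zpi_scale.
rewrite -raddf_sum; congr zpi; apply/malgP => p; rewrite mcoeff_pathalg_sum.
under eq_bigr => t _ do rewrite mcoeff_pathalgZ mcoeff_pbase.
have [z|nz] := eqVneq (x@_p) 0.
  rewrite z big1 // => t _; case: eqP => [->|_]; last by rewrite mulr0.
  by rewrite z mul0r.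
have [t et] := hb p (proj1 (homogP d x) hx p nz); rewrite et (bigD1 t) //= eqxx mulr1.
by rewrite big1 ?addr0 // => t' ne; rewrite (inj_eq ib) (negbTE ne) mulr0.
Qed.

Lemma zgr0E u : zgr 0 u -> u = \sum_i zcoef_triv i u *: zidem K i.
Proof.
move=> h; apply: (zgr_basis _ _ h) => // [i j /(congr1 (@psrc G)) //|p].
rewrite /pdeg; case=> + _; case: p => -[i [|j s]] hp //=; last by case: (typeA1 G).
by move=> _; exists i; apply: val_inj.
Qed.

(** Path length one and orientation degree zero single out the arrows of the oriented quiver. The
    loop of type A_1 has bidegree (2, 1) and does not interfere. *)
Lemma zgr10E u : zgr (1, 0) u -> u = \sum_a zcoef_arrow a u *: zarrow K (aarrow a).
Proof.
move=> h; apply: (zgr_basis _ _ h) => // [a b e|p].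
  have := congr1 (@psrc G) e; have := congr1 (@ptgt G) e.
  by rewrite /psrc /ptgt /= => e1 e2; apply/val_inj/injective_projections.
rewrite /pdeg; case; case: p => -[i [|j [|k s]]] hp //=; last by case: (typeA1 G).
- by case: (typeA1 G).
- rewrite /psrc /= addn0 => _; case hij: (arrow i j) => //= _.
  exists (exist (fun a : G * G => arrow a.1 a.2) (i, j) hij : arrows G).
  exact: val_inj.
Qed.

Lemma zgrN10_eq0 u : zgr (-1, 0) u -> u = 0.
Proof.
(* No path has negative length, so the paths of bidegree (-1, 0) are indexed by [void]. *)
move=> h; rewrite (@zgr_basis void (fun t => match t with end) (-1, 0) u) //.
by rewrite big1 // => -[].
Qed.

Lemma zcoef_triv_idem i : zcoef_triv i (zidem K i) = 1.
Proof. by rewrite /zcoef_triv zcoef_pi // mcoeff_pbase eqxx. Qed.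

Lemma zcoef_arrow_arrow a : zcoef_arrow a (zarrow K (aarrow a)) = 1.
Proof. by rewrite /zcoef_arrow zcoef_pi // mcoeff_pbase eqxx. Qed.

Lemma zcoef_trivZ (i : G) (c : K) : zcoef_triv i (c *: zidem K i) = c.
Proof.
rewrite /zcoef_triv zcoefZ; last by [].
by rewrite -/(zcoef_triv i _) zcoef_triv_idem mulr1.
Qed.

Lemma zcoef_arrowZ (a : arrows G) (c : K) : zcoef_arrow a (c *: zarrow K (aarrow a)) = c.
Proof.
rewrite /zcoef_arrow zcoefZ; last by [].
by rewrite -/(zcoef_arrow a _) zcoef_arrow_arrow mulr1.
Qed.

Lemma zcoef_arrow0 (a : arrows G) : zcoef_arrow a 0 = 0.
Proof. exact: zcoef0. Qed.

Lemma zcoef_arrow_sum (a : arrows G) (T : Type) (s : seq T) (P : pred T) (F : T -> A) :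
  zcoef_arrow a (\sum_(t <- s | P t) F t) = \sum_(t <- s | P t) zcoef_arrow a (F t).
Proof. exact: zcoef_sum. Qed.

Lemma zidem_neq0 (i : G) : zidem K i != 0.
Proof.
apply/eqP => /(congr1 (zcoef_triv i)); rewrite zcoef_triv_idem.
by rewrite /zcoef_triv zcoef0 // => /eqP; rewrite oner_eq0.
Qed.

Lemma zidem_orth (i j : G) : i != j -> zidem K i * zidem K j = 0.
Proof.
move=> /negbTE ne.
by rewrite /zidem -zpi_mul pbaseM /pbase_mul pcat_trivl /psrc /= ne raddf0.
Qed.

Lemma zarrow_orth (a : arrows G) j : atgt a != j -> zarrow K (aarrow a) * zidem K j = 0.
Proof. by move=> ne; rewrite -(zarrow_idem K (aarrow a)) -mulrA zidem_orth ?mulr0. Qed.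

(** Multiplying by e_i on the left and by e_j on the right kills every coefficient except that of
    e_i, and that one too unless i = j. *)
Lemma corner0E (i j : G) u : zgr 0 u -> zidem K i * u = u -> u * zidem K j = u ->
  u = if i == j then zcoef_triv i u *: zidem K i else 0.
Proof.
move=> h iu uj; rewrite {1}(zgr0E h).
have z l : (i != l) || (j != l) -> zcoef_triv l u = 0.
  rewrite /zcoef_triv; case/orP => /negbTE ne.
    by rewrite -iu zcoef_trivl // /psrc /= ne mul0r.
  by rewrite -uj zcoef_trivr // /ptgt /psrc /= ne mul0r.
rewrite (bigD1 i) //= big1 ?addr0 => [|l ne].
  by case: eqP => [//|/eqP ne]; rewrite z ?scale0r // eq_sym ne orbT.
by rewrite z ?scale0r // eq_sym ne.
Qed.

Lemma zcoef_arrow_src i a u : zidem K i * u = u -> asrc a != i -> zcoef_arrow a u = 0.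
Proof.
move=> iu ne; rewrite /zcoef_arrow -iu zcoef_trivl //.
by rewrite /psrc /= eq_sym (negbTE ne) mul0r.
Qed.
End ZigzagCoefficients.

(** * Bidegree-0 maps between sums of shifted projectives *)

Section ProjectiveTerms.
Variables (K : fieldType) (G : ade_quiver).
Local Notation A := (zigzag K G).
Local Notation zgr := (@zgr K G).
Local Notation zgr_scalar := (@zgr_scalar K G).
Implicit Types (V W : G -> vectType K) (n m : int).

(** The same modules as [Fsummand] and [Fterm], but with a family V that does not depend on the
    degree n, so that maps between arbitrary such sums can be treated. *)
Definition psummand n V (i : G) : gmod zgr :=
  gm_tens (gm_shift (- n, 0) (Pmod K i)) (V i).
Definition pterm n V : gmod zgr := gm_sum (psummand n V).

(** The element e_i (x) b_k, with b_k the k-th vector of [vbasis {: V i}]. These generate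
    [pterm n V]. *)
Definition pgen n V (i : G) (k : 'I_(\dim {: V i})) : pterm n V :=
  gh_inj (psummand n V) i
    (gh_inj (fun _ : 'I_(\dim {: V i}) => gm_shift (- n, 0) (Pmod K i)) k
      (lideal_gen (zidem K i))).

Definition pcoord n V (x : pterm n V) (i : G) (k : 'I_(\dim {: V i})) : A :=
  lval (x i k).

Lemma pcoord_inj n V (x y : pterm n V) :
  (forall i k, pcoord x (i := i) k = pcoord y k) -> x = y.
Proof. by move=> e; apply: dprodP => i; apply: dprodP => k; apply/lval_inj/e. Qed.

Lemma pcoordD n V (x y : pterm n V) i (k : 'I_(\dim {: V i})) :
  pcoord (x + y) k = pcoord x k + pcoord y k.
Proof. by []. Qed.

Lemma pcoordZ n V (a : A) (x : pterm n V) i (k : 'I_(\dim {: V i})) :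
  pcoord (a *: x) k = a * pcoord x k.
Proof. by []. Qed.

Lemma pcoord_sum n V (T : Type) (s : seq T) (P : pred T) (F : T -> pterm n V)
    i (k : 'I_(\dim {: V i})) :
  pcoord (\sum_(t <- s | P t) F t) k = \sum_(t <- s | P t) pcoord (F t) k.
Proof.
apply: (big_morph (fun x : pterm n V => pcoord x k)) => [x y|]; first exact: pcoordD.
by [].
Qed.

Lemma pcoord_pgen n V i (k l : 'I_(\dim {: V i})) :
  pcoord (pgen n k) l = (k == l)%:R * zidem K i.
Proof.
rewrite /pcoord /pgen /= dinjE; have [<-|ne] := eqVneq k l.
  by rewrite dinjE mul1r.
by rewrite dinj_out // mul0r.
Qed.

Lemma pcoord_pgen_out n V i j (k : 'I_(\dim {: V i})) (l : 'I_(\dim {: V j})) :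
  i != j -> pcoord (pgen n k) l = 0.
Proof. by move=> ne; rewrite /pcoord /pgen /= dinj_out. Qed.

Lemma pcoord_idem n V (x : pterm n V) i (k : 'I_(\dim {: V i})) :
  pcoord x k * zidem K i = pcoord x k.
Proof. exact/lidealE/zidemM. Qed.

Lemma pcoord_gr n V (x : pterm n V) d i (k : 'I_(\dim {: V i})) :
  gr d x -> zgr (d + (n, 0)) (pcoord x k).
Proof.
move=> /(_ i k) h; have -> : d + (n, 0) = d - (- n, 0); last exact: h.
by case: d {h} => a b; congr pair; rewrite /= opprK.
Qed.

Lemma pgen_gr n V i (k : 'I_(\dim {: V i})) : gr (- n, 0) (pgen n k).
Proof.
do 2!apply: gh_gr; rewrite /= subrr; exact: zidem_gr.
Qed.

Lemma pgen_idem n V i (k : 'I_(\dim {: V i})) : zidem K i *: pgen n k = pgen n k.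
Proof.
rewrite /pgen -!linearZ; do 2!congr (gh_inj _ _ _).
by apply: lval_inj; rewrite linearZ; apply: zidemM.
Qed.

Lemma pterm_gens n V (x : pterm n V) : x = \sum_i \sum_k pcoord x k *: pgen n (i := i) k.
Proof.
apply: pcoord_inj => j l; rewrite pcoord_sum (bigD1 j) //= [X in _ + X]big1 => [|i ne].
  rewrite addr0 pcoord_sum (bigD1 l) //= big1 => [|k ne].
    by rewrite addr0 pcoordZ pcoord_pgen eqxx mul1r pcoord_idem.
  by rewrite pcoordZ pcoord_pgen (negbTE ne) mul0r mulr0.
rewrite pcoord_sum big1 // => k _.
by rewrite pcoordZ pcoord_pgen_out // mulr0.
Qed.

Lemma pterm_hom_ext n V (N : gmod zgr) (f g : gmhom (pterm n V) N) :
  (forall i k, f (pgen n (i := i) k) = g (pgen n k)) -> f = g.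
Proof.
move=> e; apply: gmhomP => x; rewrite (pterm_gens x) !linear_sum.
apply: eq_bigr => i _; rewrite !linear_sum; apply: eq_bigr => k _.
by rewrite !linearZ /= e.
Qed.

Lemma lfun_of_coef (V W : vectType K) (c : 'I_(\dim {: W}) -> 'I_(\dim {: V}) -> K) :
  {g : 'Hom(V, W) | forall l k, lfun_coef g l k = c l k}.
Proof.
have [|g hg] := @linfun_exists K V W (fun v => \sum_l
    (\sum_k c l k * coord (vbasis {: V}) k v) *: (vbasis {: W})`_l).
  move=> a x y; rewrite scaler_sumr -big_split; apply: eq_bigr => l _ /=.
  rewrite scalerA -scalerDl mulr_sumr -big_split; congr (_ *: _).
  by apply: eq_bigr => k _; rewrite /= linearP mulrDr mulrCA.
exists g => l k; rewrite /lfun_coef hg coord_sum_free ?(basis_free (vbasisP _)) //.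
rewrite (bigD1 k) //= big1 ?addr0 => [|k' ne].
  by rewrite coord_free ?(basis_free (vbasisP _)) // eqxx mulr1.
by rewrite coord_free ?(basis_free (vbasisP _)) // eq_sym (negbTE ne) mulr0.
Qed.

Lemma lfun_coef_inj (V W : vectType K) (f g : 'Hom(V, W)) :
  (forall l k, lfun_coef f l k = lfun_coef g l k) -> f = g.
Proof.
move=> e; apply/lfunP => v.
rewrite (coord_vbasis (memvf (f v))) (coord_vbasis (memvf (g v))).
apply: eq_bigr => l _; rewrite -!lfun_coefP; congr (_ *: _).
by apply: eq_bigr => k _; rewrite e.
Qed.

Definition pmap0 n V W (g : forall i, 'Hom(V i, W i)) : gmhom (pterm n V) (pterm n W) :=
  gh_sum (fun i => gh_tens zgr_scalar (gh_id _) (g i) :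
                     gmhom (psummand n V i) (psummand n W i)).

Definition pmap1_arrow n V W (a : arrows G) (r : 'Hom(V (asrc a), W (atgt a))) :
    gmhom (pterm n V) (pterm (n + 1) W) :=
  gh_comp (gh_inj (psummand (n + 1) W) (atgt a))
    (gh_comp (gh_tens zgr_scalar (xmap K a n) r :
                gmhom (psummand n V (asrc a)) (psummand (n + 1) W (atgt a)))
      (gh_proj (psummand n V) (asrc a))).

(** The shape of the differential of F, the sum over all arrows a of x_a (x) r_a, just as [pmap0] is
    the shape of F on morphisms. *)
Definition pmap1 n V W (r : forall a : arrows G, 'Hom(V (asrc a), W (atgt a))) :
    gmhom (pterm n V) (pterm (n + 1) W) :=
  \sum_a pmap1_arrow n (r a).

Lemma pcoord_pmap0 n V W (g : forall i, 'Hom(V i, W i)) x i (l : 'I_(\dim {: W i})) :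
  pcoord (pmap0 n g x) l = \sum_k lfun_coef (g i) l k *: pcoord x k.
Proof.
rewrite /pcoord /= linear_sum; apply: eq_bigr => k _.
by rewrite linearZ; apply: mulr_algl.
Qed.

Lemma pcoord_pmap1_arrow n V W (a : arrows G) (r : 'Hom(V (asrc a), W (atgt a)))
    x (l : 'I_(\dim {: W (atgt a)})) :
  pcoord (pmap1_arrow n r x) l =
  \sum_k lfun_coef r l k *: (pcoord x k * zarrow K (aarrow a)).
Proof.
rewrite /pcoord /= dinjE linear_sum; apply: eq_bigr => k _.
by rewrite linearZ; apply: mulr_algl.
Qed.

Lemma pcoord_pmap1_arrow_out n V W (a : arrows G) (r : 'Hom(V (asrc a), W (atgt a)))
    x j (l : 'I_(\dim {: W j})) :
  atgt a != j -> pcoord (pmap1_arrow n r x) l = 0.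
Proof. by move=> ne; rewrite /pcoord /= dinj_out. Qed.

Lemma pcoord_pmap0_pgen n V W (g : forall i, 'Hom(V i, W i)) i
    (k : 'I_(\dim {: V i})) (l : 'I_(\dim {: W i})) :
  pcoord (pmap0 n g (pgen n k)) l = lfun_coef (g i) l k *: zidem K i.
Proof.
rewrite pcoord_pmap0 (bigD1 k) //= big1 ?addr0 => [|k' ne].
  by rewrite pcoord_pgen eqxx mul1r.
by rewrite pcoord_pgen eq_sym (negbTE ne) mul0r scaler0.
Qed.

Lemma pcoord_pmap1_arrow_pgen n V W (a : arrows G) (r : 'Hom(V (asrc a), W (atgt a)))
    (k : 'I_(\dim {: V (asrc a)})) (l : 'I_(\dim {: W (atgt a)})) :
  pcoord (pmap1_arrow n r (pgen n k)) l = lfun_coef r l k *: zarrow K (aarrow a).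
Proof.
rewrite pcoord_pmap1_arrow (bigD1 k) //= big1 ?addr0 => [|k' ne].
  by rewrite pcoord_pgen eqxx mul1r zidem_arrow.
by rewrite pcoord_pgen eq_sym (negbTE ne) !mul0r scaler0.
Qed.

Lemma pcoord_pmap1_arrow_pgen_out n V W (a : arrows G) (r : 'Hom(V (asrc a), W (atgt a)))
    i (k : 'I_(\dim {: V i})) (l : 'I_(\dim {: W (atgt a)})) :
  i != asrc a -> pcoord (pmap1_arrow n r (pgen n k)) l = 0.
Proof.
move=> ne; rewrite pcoord_pmap1_arrow big1 // => k' _.
by rewrite pcoord_pgen_out // mul0r scaler0.
Qed.

Section HomCoefficients.
Variables (n m : int) (V W : G -> vectType K) (f : gmhom (pterm n V) (pterm m W)).
Variables (i j : G) (k : 'I_(\dim {: V i})) (l : 'I_(\dim {: W j})).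

(** The shift puts [pgen] in bidegree (-n, 0), and undoing the shift of the target adds (m, 0). *)
Lemma pcoord_hom_gr : zgr (m - n, 0) (pcoord (f (pgen n k)) l).
Proof.
have -> : (m - n, 0) = (- n, 0) + (m, 0) :> (int * int)%type.
  by congr pair; rewrite /= ?addr0 // addrC.
exact/pcoord_gr/gh_gr/pgen_gr.
Qed.

Lemma pcoord_hom_idem : zidem K i * pcoord (f (pgen n k)) l = pcoord (f (pgen n k)) l.
Proof. by rewrite -pcoordZ -linearZ pgen_idem. Qed.
End HomCoefficients.

(** The entries of f between generators have bidegree 0 and lie in e_i A e_j, so they are multiples
    of e_i for i = j and 0 otherwise. These scalars are the matrix of [g i]. *)
Lemma pmap0_surj n V W (f : gmhom (pterm n V) (pterm n W)) : exists g, f = pmap0 n g.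
Proof.
pose g i : 'Hom(V i, W i) := sval (lfun_of_coef (fun l k =>
  zcoef_triv i (pcoord (f (pgen n (i := i) k)) l))).
have gE i l k : lfun_coef (g i) l k = zcoef_triv i (pcoord (f (pgen n (i := i) k)) l).
  exact: (svalP (lfun_of_coef _)).
exists g; apply: pterm_hom_ext => i k; apply: pcoord_inj => j l.
have h := pcoord_hom_gr f k l; rewrite subrr in h.
rewrite (corner0E h (pcoord_hom_idem f k l) (pcoord_idem _ l)).
case: eqVneq => [e|ne]; last first.
  by rewrite pcoord_pmap0 big1 // => k' _; rewrite pcoord_pgen_out ?scaler0.
(* The type of l depends on j, so the equality of vertices is eliminated instead of rewritten. *)
by case: j / e l h => l h; rewrite pcoord_pmap0_pgen gE.
Qed.

Lemma pmap0_inj n V W (g g' : forall i, 'Hom(V i, W i)) :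
  pmap0 n g = pmap0 n g' -> forall i, g i = g' i.
Proof.
move=> e i; apply: lfun_coef_inj => l k.
have E (h : forall i, 'Hom(V i, W i)) :
    zcoef_triv i (pcoord (pmap0 n h (pgen n k)) l) = lfun_coef (h i) l k.
  by rewrite pcoord_pmap0_pgen zcoef_trivZ.
by rewrite -!E e.
Qed.

Lemma zcoef_pmap1 n V W (r : forall a : arrows G, 'Hom(V (asrc a), W (atgt a)))
    (a : arrows G) k l :
  zcoef_arrow a (pcoord (pmap1 n r (pgen n k)) l) = lfun_coef (r a) l k.
Proof.
rewrite /pmap1 gh_sumE pcoord_sum zcoef_arrow_sum (bigD1 a) //= big1.
  by rewrite addr0 pcoord_pmap1_arrow_pgen zcoef_arrowZ.
move=> b ne; have [et|nt] := eqVneq (atgt b) (atgt a); last first.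
  by rewrite pcoord_pmap1_arrow_out ?zcoef_arrow0.
(* An arrow is recorded as a pair of vertices, so distinct arrows with the same target have distinct
   sources. *)
have ns : asrc a != asrc b.
  apply: contra ne => /eqP es; apply/eqP/val_inj.
  by apply: injective_projections; [apply: esym es|apply: et].
by case: (atgt a) / et l => l; rewrite pcoord_pmap1_arrow_pgen_out ?zcoef_arrow0.
Qed.

Lemma pmap1_inj n V W (r r' : forall a : arrows G, 'Hom(V (asrc a), W (atgt a))) :
  pmap1 n r = pmap1 n r' -> forall a, r a = r' a.
Proof.
by move=> e a; apply: lfun_coef_inj => l k; rewrite -!(zcoef_pmap1 n) e.
Qed.

Lemma pmap1_surj n V W (f : gmhom (pterm n V) (pterm (n + 1) W)) :
  exists r, f = pmap1 n r.
Proof.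
pose r a : 'Hom(V (asrc a), W (atgt a)) := sval (lfun_of_coef (fun l k =>
  zcoef_arrow a (pcoord (f (pgen n (i := asrc a) k)) (i := atgt a) l))).
have rE a l k : lfun_coef (r a) l k =
    zcoef_arrow a (pcoord (f (pgen n (i := asrc a) k)) (i := atgt a) l).
  exact: (svalP (lfun_of_coef _)).
exists r; apply: pterm_hom_ext => i k; apply: pcoord_inj => j l.
have h := pcoord_hom_gr f k l; rewrite addrAC subrr add0r in h.
(* Expand the entry in the arrows of the quiver: e_j on the right leaves those ending at j, and e_i
   on the left leaves those starting at i. *)
rewrite -[LHS](pcoord_idem _ l) {1}(zgr10E h) mulr_suml /pmap1 gh_sumE pcoord_sum.
apply: eq_bigr => a _; rewrite -scalerAl; have [et|nt] := eqVneq (atgt a) j; last first.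
  by rewrite zarrow_orth // scaler0 pcoord_pmap1_arrow_out.
case: j / et l h => l h; rewrite zarrow_idem.
have [es|ns] := eqVneq (asrc a) i; last first.
  rewrite (zcoef_arrow_src (pcoord_hom_idem f k l) ns) scale0r.
  by rewrite pcoord_pmap1_arrow_pgen_out // eq_sym.
by case: i / es k h => k h; rewrite pcoord_pmap1_arrow_pgen rE.
Qed.

(** The entries have bidegree (-1, 0), where the zigzag algebra vanishes. This is what kills
    homotopies. *)
Lemma pterm_homN10 n V W (f : gmhom (pterm (n + 1) V) (pterm n W)) : f = 0.
Proof.
apply: pterm_hom_ext => i k; apply: pcoord_inj => j l.
have := pcoord_hom_gr f k l; rewrite opprD addrA subrr add0r => h.
by rewrite (zgrN10_eq0 h).
Qed.
End ProjectiveTerms.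

(** * The functor F *)

Section GradedIsomorphisms.
Variables (K : fieldType) (A : algType K) (Agr : int * int -> A -> Prop).

Lemma gm_iso_sym (M N : gmod Agr) : gm_iso M N -> gm_iso N M.
Proof. by case=> f [g [fK gK]]; exists g, f. Qed.

Lemma gm_iso_trans (L M N : gmod Agr) : gm_iso L M -> gm_iso M N -> gm_iso L N.
Proof.
case=> f [g [fK gK]] [f' [g' [fK' gK']]]; exists (gh_comp f' f), (gh_comp g g').
by split=> x /=; rewrite ?fK' ?fK ?gK ?gK'.
Qed.

Lemma gm_iso_bij (M N : gmod Agr) (f : gmhom M N) : bijective f ->
  (forall d x, gr d (f x) -> gr d x) -> gm_iso M N.
Proof.
case=> g fK gK hf.
have gl : linear g by move=> a x y; apply: (can_inj fK); rewrite gK linearP /= !gK.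
have gg d y : gr d y -> gr d (g y) by move=> h; apply: hf; rewrite gK.
by exists f, (GMHom gl gg); split=> x; [apply: fK|apply: gK].
Qed.

Lemma gm_sum_reindex (J J' : finType) (M : J -> gmod Agr) (s : J' -> J) :
  injective s -> (forall j, exists j', s j' = j) ->
  gm_iso (gm_sum M) (gm_sum (fun j' => M (s j'))).
Proof.
move=> sI sS.
have fl : linear (fun (x : gm_sum M) => (fun j' => x (s j')) : gm_sum (fun j' => M (s j'))).
  by [].
have fg d (x : gm_sum M) : gr d x -> gr d ((fun j' => x (s j')) : gm_sum (fun j' => M (s j'))).
  by move=> h j'; apply: h.
apply: (@gm_iso_bij _ _ (GMHom fl fg)) => [|d x h j]; last first.
  by have [j' <-] := sS j; apply: h.
(* The inverse takes at j the component at a preimage j' of j, transported along [s j' = j];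
   injectivity of s makes the result independent of j' and of the proof. *)
have ex (y : gm_sum (fun j' => M (s j'))) j :
    exists u : M j, forall j' (e : s j' = j), eq_rect _ (fun l => M l : Type) (y j') _ e = u.
  have [j0 e0] := sS j; case: j / e0; exists (y j0) => j' e.
  by have e' := sI _ _ e; subst j'; rewrite (eq_irrelevance e erefl).
exists (fun y j => projT1 (cid (ex y j))) => [x|y]; apply: dprodP => j.
  case: (cid _) => /= u hu; have [j' e] := sS j.
  by rewrite -(hu j' e); case: j / e {u hu}.
by rewrite /=; case: (cid _) => /= u /(_ j erefl).
Qed.
End GradedIsomorphisms.

(* Fterm V n and pterm n (fun i => V i n) are convertible, but unless these
   constants are unfolded before gm_sum, comparing them compares the bodies of
   the proofs inside gm_sum. *)
Strategy expand [Fterm Fsummand pterm psummand Fdiff Fdiff_arrow pmap1 pmap1_arrow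
  Fmor_term pmap0].

(** * Full faithfulness, minimality and essential surjectivity of F *)

Section Functor.
Variables (K : fieldType) (G : ade_quiver).
Local Notation A := (zigzag K G).
Local Notation zgr := (@zgr K G).

Lemma pterm_iso n (V : G -> vectType K) :
  gm_iso (pterm n V) (gm_sum (fun t : {i : G & 'I_(\dim {: V i})} =>
    gm_shift (- n, 0) (Pmod K (tag t)))).
Proof.
set N := gm_sum _.
have fl : linear (fun x : pterm n V => (fun t => x (tag t) (tagged t)) : N) by [].
have fg d (x : pterm n V) : gr d x -> gr d ((fun t => x (tag t) (tagged t)) : N).
  by move=> h t; apply: h.
apply: (@gm_iso_bij _ _ _ _ _ (GMHom fl fg)) => [|d x h i k]; last first.
  exact: (h (existT _ i k)).
exists (fun (y : N) i k => y (existT _ i k)) => [x|y].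
  exact: erefl.
by apply: functional_extensionality_dep => -[].
Qed.

(** The dimension of [V i] is the number of j with v j = i, and [s] matches the basis of [V i] with
    these j. *)
Lemma pterm_of_sum n (J : finType) (v : J -> G) : exists V : G -> vectType K,
  gm_iso (gm_sum (fun j => gm_shift (- n, 0) (Pmod K (v j)))) (pterm n V).
Proof.
pose V i : vectType K := 'rV[K]_(#|[pred j | v j == i]|).
have dV i : \dim {: V i} = #|[pred j | v j == i]| by rewrite dimvf /dim /= mul1n.
pose s (t : {i : G & 'I_(\dim {: V i})}) : J := enum_val (cast_ord (dV (tag t)) (tagged t)).
have vs t : v (s t) = tag t.
  by have /eqP := enum_valP (cast_ord (dV (tag t)) (tagged t)).
have sI : injective s.
  move=> [i k] [i' k'] e; have := congr1 v e; rewrite !vs /= => ei.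
  by subst i'; congr existT; move: e => /enum_val_inj/cast_ord_inj.
have sS j : exists t, s t = j.
  have jP : j \in [pred j' | v j' == v j] by rewrite inE.
  exists (Tagged (fun i => 'I_(\dim {: V i})) (cast_ord (esym (dV (v j))) (enum_rank_in jP j))).
  by rewrite /s /= cast_ordKV enum_rankK_in.
exists V; apply: gm_iso_trans (gm_iso_sym (pterm_iso n V)).
have -> : (fun t => gm_shift (- n, 0) (Pmod K (tag t))) =
    (fun t => gm_shift (- n, 0) (Pmod K (v (s t)))) by apply/funext => t; rewrite vs.
exact: (@gm_sum_reindex _ _ _ _ _ (fun j => gm_shift (- n, 0) (Pmod K (v j))) s sI sS).
Qed.

Lemma pmap0_pmap1 n (U V W : G -> vectType K) (g : forall i, 'Hom(V i, W i))
    (r : forall a : arrows G, 'Hom(U (asrc a), V (atgt a))) x :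
  pmap0 (n + 1) g (pmap1 n r x) = pmap1 n (fun a => g (atgt a) \o r a)%VF x.
Proof.
rewrite /pmap1 !gh_sumE linear_sum; apply: eq_bigr => a _.
apply: etrans (gh_sum_inj _ _) _; congr (gh_inj _ _ _).
apply: etrans (esym (gh_tens_compE _ _ _ _ _ _)) _.
by rewrite gh_comp1l.
Qed.

Lemma pmap1_pmap0 n (U V W : G -> vectType K) (g : forall i, 'Hom(U i, V i))
    (r : forall a : arrows G, 'Hom(V (asrc a), W (atgt a))) x :
  pmap1 n r (pmap0 n g x) = pmap1 n (fun a => r a \o g (asrc a))%VF x.
Proof.
rewrite /pmap1 !gh_sumE; apply: eq_bigr => a _; congr (gh_inj _ _ _).
apply: etrans (esym (gh_tens_compE _ _ _ _ _ _)) _.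
by rewrite gh_comp1r.
Qed.

(** A homotopy goes from degree n + 1 to degree n, hence is zero by [pterm_homN10]. So maps in the
    homotopy category between such complexes are the same as chain maps. *)
Lemma Fcplx_null_homotopic (V W : grep K G) (f : chmap (Fcplx V) (Fcplx W)) :
  null_homotopic f -> f = 0.
Proof.
case=> h hh.
have h0 n : h n = 0.
  exact: (@pterm_homN10 K G n (fun i => V i (n + 1)) (fun i => W i n) (h n)).
(* [null_homotopic] describes f in degrees of the form n + 1, so n is written as (n - 1) + 1. *)
apply: chmapP => n; rewrite -(subrK 1 n) => x.
by rewrite hh !h0 /= linear0 addr0.
Qed.

Lemma lfun_coefD (V W : vectType K) (f g : 'Hom(V, W)) l k :
  lfun_coef (f + g) l k = lfun_coef f l k + lfun_coef g l k.
Proof. by rewrite /lfun_coef add_lfunE linearD. Qed.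

Lemma pmap0D n (V W : G -> vectType K) (g g' : forall i, 'Hom(V i, W i)) x :
  pmap0 n (fun i => g i + g' i) x = pmap0 n g x + pmap0 n g' x.
Proof.
apply: pcoord_inj => i l; apply: etrans (pcoord_pmap0 _ _ _) _.
apply: etrans _ (congr2 +%R (esym (pcoord_pmap0 _ _ _)) (esym (pcoord_pmap0 _ _ _))).
rewrite -big_split.
by apply: eq_bigr => k _; rewrite lfun_coefD scalerDl.
Qed.

Lemma Ffun_additive : additive_functor (Ffun K G).
Proof.
move=> V W f g; rewrite -[RHS]raddfD; congr htpi.
apply: chmapP => n x.
exact: (pmap0D (n := n) (V := fun i => V i n) (W := fun i => W i n)
  (fun i => f i n) (fun i => g i n) x).
Qed.

(** Each component is a [pmap0], so both sides of the chain map condition are [pmap1] of composites.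
    Injectivity of [pmap1] turns the condition into commutation with the arrows. *)
Lemma pterm_chain_maps (V W : int -> G -> vectType K)
    (r : forall n (a : arrows G), 'Hom(V n (asrc a), V (n + 1) (atgt a)))
    (r' : forall n (a : arrows G), 'Hom(W n (asrc a), W (n + 1) (atgt a)))
    (f : forall n, gmhom (pterm n (V n)) (pterm n (W n))) :
  (forall n x, f (n + 1) (pmap1 n (r n) x) = pmap1 n (r' n) (f n x)) ->
  exists g : forall n i, 'Hom(V n i, W n i), (forall n, f n = pmap0 n (g n)) /\
    forall n a, (g (n + 1) (atgt a) \o r n a)%VF = (r' n a \o g n (asrc a))%VF.
Proof.
move=> fc; pose g n := projT1 (cid (pmap0_surj (f n))).
have fE n : f n = pmap0 n (g n) by exact: (projT2 (cid (pmap0_surj (f n)))).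
exists g; split=> // n; apply: (@pmap1_inj K G n (V n) (W (n + 1))).
apply: gmhomP => x; have := fc n x; rewrite !fE => e.
exact: etrans (esym (pmap0_pmap1 _ _ _)) (etrans e (pmap1_pmap0 _ _ _)).
Qed.

Lemma Ffun_fully_faithful : fully_faithful (Ffun K G).
Proof.
move=> V W phi; pose f : chmap (Fcplx V) (Fcplx W) := repr phi.
pose V' n i := V i n; pose W' n i := W i n.
pose f' n : gmhom (pterm n (V' n)) (pterm n (W' n)) := f n.
have fc n x : f' (n + 1) (pmap1 n (V := V' n) (W := V' (n + 1)) (fun a => rmap V a n) x) =
    pmap1 n (V := W' n) (W := W' (n + 1)) (fun a => rmap W a n) (f' n x).
  exact: (ch_comm f x).
have [g [fE gc]] := @pterm_chain_maps V' W' (fun n a => rmap V a n) (fun n a => rmap W a n) f' fc.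
exists (@RepHom K G V W (fun i n => g n i) (fun a n => gc n a)); split.
  rewrite -[RHS]htpiK; congr htpi; apply: chmapP => n x.
  exact: (esym (congr1 (fun h : gmhom _ _ => h x) (fE n))).
(* Uniqueness: f and [Fmor g'] are homotopic, hence equal, and [pmap0] is injective. *)
move=> g' eg'; apply: rephomP => i n.
have /Fcplx_null_homotopic/eqP : null_homotopic (f - Fmor g').
  by apply/htpi_eq; rewrite htpiK -eg'.
rewrite subr_eq0 => /eqP ef.
have e : pmap0 n (g n) = pmap0 n (fun i => g' i n).
  exact: etrans (esym (fE n)) (congr1 (fun h : chmap (Fcplx V) (Fcplx W) => h n) ef).
exact: (pmap0_inj e i).
Qed.

(** The endomorphism i p of F(V) factors through the contractible X, so it is null-homotopic and
    hence 0. Then id_X = (p i)(p i) = 0. *)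
Lemma Fcplx_minimal (V : grep K G) : minimal (Fcplx V).
Proof.
move=> X Y i j p q [pi _ _ _ _] cX; apply: is_zero_idc.
have ip0 : i \oc p = 0.
  apply: (@Fcplx_null_homotopic V V); rewrite -(compc1 i).
  exact/null_homotopicr/null_homotopicl.
by rewrite -[LHS]comp1c -pi -compcA (compcA i) ip0 comp0c compc0.
Qed.

Lemma Ffun_in_K00 (V : Rep K G) : in_K00 (Ffun K G V).
Proof.
exists (Fcplx V); split.
- by exists (idc _), (idc _); rewrite !comp1c.
- exact: Fcplx_minimal.
- move=> k; exists {i : G & 'I_(\dim {: (V : grep K G) i k})}, (fun t => tag t).
  exact: (pterm_iso k (fun i => (V : grep K G) i k)).
Qed.

(** Replace each term of M by an isomorphic [pterm] and conjugate the differential; by [pmap1_surj]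
    it becomes a family of linear maps along the arrows. The quiver carries no relations, so any
    such bounded family is a representation. *)
Lemma Fcplx_surj (M : cplx zgr) :
  (forall k : int, exists (J : finType) (v : J -> G),
    gm_iso (M k) (gm_sum (fun j => gm_shift (- k, 0) (Pmod K (v j))))) ->
  exists V : grep K G, isomorphic (Fcplx V : Ho zgr) M.
Proof.
move=> hM.
have exV n : exists V : G -> vectType K, gm_iso (M n) (pterm n V).
  have [J [v hv]] := hM n; have [V hV] := pterm_of_sum n v.
  by exists V; apply: gm_iso_trans hv hV.
pose V n := projT1 (cid (exV n)).
have [phi hphi] : {phi : forall n, gmhom (M n) (pterm n (V n)) |
    forall n, exists psi : gmhom (pterm n (V n)) (M n),
      cancel (phi n) psi /\ cancel psi (phi n)}.
  exists (fun n => projT1 (cid (projT2 (cid (exV n))))) => n.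
  exact: (projT2 (cid (projT2 (cid (exV n))))).
pose psi n := projT1 (cid (hphi n)).
have phiK n : cancel (phi n) (psi n) by case: (projT2 (cid (hphi n))).
have psiK n : cancel (psi n) (phi n) by case: (projT2 (cid (hphi n))).
have exr n : exists r : forall a : arrows G, 'Hom(V n (asrc a), V (n + 1) (atgt a)),
    gh_comp (phi (n + 1)) (gh_comp (cdiff M n) (psi n)) = pmap1 n r.
  exact: pmap1_surj.
pose r a n := projT1 (cid (exr n)) a.
have rP n x : phi (n + 1) (cdiff M n (psi n x)) = pmap1 n (fun a => r a n) x.
  exact: (congr1 (fun f : gmhom _ _ => f x) (projT2 (cid (exr n)))).
(* Where M vanishes so does V: a non-zero [V m i] would give a generator with coordinate e_i, which
   is non-zero. *)
have fin : exists N : nat, forall i (m : int), (N < `|m|)%N -> \dim {: V m i} = 0%N.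
  have [N hN] := cterm_bounded M; exists N => i m /hN M0; apply/eqP/negPn/negP.
  rewrite -lt0n => d0; pose k := Ordinal d0; have /eqP := zidem_neq0 K i; apply.
  have <- : pcoord (pgen m k) k = zidem K i by rewrite pcoord_pgen eqxx mul1r.
  by rewrite -(psiK m (pgen m k)) (M0 (psi m _)) linear0.
pose R := @GRep K G (fun i m => V m i) r fin.
(* By [rP] the differential of F(R) is phi d psi, so phi and psi commute with the differentials. *)
have phic n x : phi (n + 1) (cdiff M n x) = cdiff (Fcplx R) n (phi n x).
  exact: etrans (congr1 (fun y => phi (n + 1) (cdiff M n y)) (esym (phiK n x))) (rP n _).
have psic n x : psi (n + 1) (cdiff (Fcplx R) n x) = cdiff M n (psi n x).
  exact: etrans (congr1 (psi (n + 1)) (esym (rP n x))) (phiK _ _).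
pose Phi : chmap M (Fcplx R) := @ChMap _ _ _ M (Fcplx R) phi phic.
pose Psi : chmap (Fcplx R) M := @ChMap _ _ _ (Fcplx R) M psi psic.
exists R, (htpi Psi), (htpi Phi); split; apply: etrans (ht_compE _ _) _;
  congr htpi; apply: chmapP => n x.
- exact: psiK.
- exact: phiK.
Qed.
End Functor.

(** * Restriction of the target to a full subcategory *)

Section Corestriction.
Variables (C D : precat) (F : functor C D) (P : D -> Prop) (h : forall X, P (F X)).

Lemma corestrict_fully_faithful : fully_faithful F -> fully_faithful (corestrict h).
Proof. by move=> ff X Y f; apply: ff. Qed.

Lemma corestrict_essentially_surjective :
  (forall Y, P Y -> exists X, isomorphic (F X) Y) ->
  essentially_surjective (corestrict h).
Proof. by move=> es [Y PY]; have [X XY] := es Y PY; exists X. Qed.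

Lemma corestrict_additive : additive_functor F -> additive_functor (corestrict h).
Proof. by move=> ad X Y f g; apply: ad. Qed.
End Corestriction.

(** [Ffun] takes values in the whole homotopy category; the witness [h] is what allows it to be
    corestricted to [K00]. *)
Theorem proposition2p6 (R : realType) (G : ade_quiver) :
  exists h : forall V : Rep R[i] G, in_K00 (Ffun R[i] G V),
    abelian_equivalence (corestrict h : functor (Rep R[i] G) (K00 R[i] G)).
Proof.
exists (@Ffun_in_K00 R[i] G); apply: ff_es_abelian_equivalence.
- exact/corestrict_fully_faithful/Ffun_fully_faithful.
(* The terms of the minimal complex M of X have the shape required by [Fcplx_surj], so some F(V) is
   isomorphic to M and hence to X. *)
- apply: corestrict_essentially_surjective => X [M [MX _ hM]].
  have [V VM] := Fcplx_surj hM.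
  by exists V; apply: isomorphic_trans VM MX.
- exact/corestrict_additive/Ffun_additive.
- exact: Rep_abelian.
Qed.
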